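(* Let $d\ge 1$ be real. Given an $n$-vertex bipartite graph $G$ of average degree at most $d$, one can count the number of perfect matchings in $G$ in $\mathcal{O}^\star\bigl(2^{(1-1/(3.55\, d))\,n/2}\bigr)$ time and exponential space.
   Context: Graphs are finite. The average degree of an $n$-vertex graph $G=(V,E)$ is $\frac1n\sum_{v\in V}\deg(v) = 2|E|/n$. The notation $\mathcal{O}^\star(\cdot)$ suppresses factors polynomial in the input size. ''Exponential space'' means that the space used is not restricted to be polynomial. *)

(* Defs.v *)
From HB Require Import structures.
From mathcomp Require Import all_boot all_order all_algebra.
From mathcomp Require Import reals exp.

Set Implicit Arguments.
Unset Strict Implicit.
Unset Printing Implicit Defensive.

Import Order.TTheory GRing.Theory Num.Theory.

Record sgraph (V : finType) := SGraph {
  adj :> rel V;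
  adj_sym : symmetric adj;
  adj_irr : irreflexive adj
}.

Section Graphs.
Variables (V : finType) (G : sgraph V).

Definition degree (v : V) : nat := #|[set w | G v w]|.

(* On the empty graph this is 0 / 0 = 0. *)
Definition average_degree (R : realType) : R :=
  ((\sum_(v : V) degree v)%N%:R / #|V|%:R)%R.

Definition bipartite : Prop :=
  exists A : {set V}, forall v w, G v w -> (v \in A) != (w \in A).

Definition edges : {set {set V}} :=
  [set [set p.1; p.2] | p : V * V & G p.1 p.2].

Definition perfect_matchings : {set {set {set V}}} :=
  [set M : {set {set V}} | (M \subset edges)
     && [forall v : V, #|[set f in M | v \in f]| == 1%N]].

End Graphs.

(* Random access machine with logarithmic cost, programmed with structured    *)
(* control flow.  The memory is an infinite array of natural numbers; every   *)
(* elementary operation is charged the bit lengths of all the numbers,        *)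
(* addresses included, that it handles.                                       *)

Definition memory := nat -> nat.

Definition upd (m : memory) (a v : nat) : memory := fun k => if k == a then v else m k.

Inductive binop := Add | Sub | Mul | Div.

Inductive expr :=
| Const of nat
| Get of expr
| Bin of binop & expr & expr.

Inductive prog :=
| Skip
| Put of expr & expr
| Seq of prog & prog
| If of expr & prog & prog
| While of expr & prog.

(* Subtraction is truncated at 0, and x / 0 = 0. *)
Definition binop_eval (o : binop) : nat -> nat -> nat :=
  match o with Add => addn | Sub => subn | Mul => muln | Div => divn end.

(* The number of binary digits, with bitlen 0 = 1. *)
Definition bitlen (x : nat) : nat := (trunc_log 2 x).+1.

Fixpoint eval (m : memory) (e : expr) : nat :=
  match e with
  | Const c => c
  | Get a => m (eval m a)
  | Bin o e1 e2 => binop_eval o (eval m e1) (eval m e2)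
  end.

Fixpoint eval_cost (m : memory) (e : expr) : nat :=
  match e with
  | Const c => bitlen c
  | Get a => eval_cost m a + bitlen (eval m a) + bitlen (eval m e)
  | Bin _ e1 e2 => eval_cost m e1 + eval_cost m e2
      + bitlen (eval m e1) + bitlen (eval m e2) + bitlen (eval m e)
  end.

(* exec m p t m' : started in memory m, the program p halts in memory m'      *)
(* after time t.  A test succeeds when its value is not 0.                    *)
Inductive exec : memory -> prog -> nat -> memory -> Prop :=
| ExecSkip m : exec m Skip 1 m
| ExecPut m a e :
    exec m (Put a e)
      (eval_cost m a + eval_cost m e + bitlen (eval m a) + bitlen (eval m e))
      (upd m (eval m a) (eval m e))
| ExecSeq m m' m'' p q t u :
    exec m p t m' -> exec m' q u m'' -> exec m (Seq p q) (t + u) m''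
| ExecIfTrue m m' e p q t :
    eval m e != 0 -> exec m p t m' ->
    exec m (If e p q) (eval_cost m e + bitlen (eval m e) + t) m'
| ExecIfFalse m m' e p q t :
    eval m e = 0 -> exec m q t m' ->
    exec m (If e p q) (eval_cost m e + bitlen (eval m e) + t) m'
| ExecWhileTrue m m' m'' e p t u :
    eval m e != 0 -> exec m p t m' -> exec m' (While e p) u m'' ->
    exec m (While e p) (eval_cost m e + bitlen (eval m e) + t + u) m''
| ExecWhileFalse m e p :
    eval m e = 0 -> exec m (While e p) (eval_cost m e + bitlen (eval m e)) m.

Lemma exec_deterministic m p t1 m1 t2 m2 :
  exec m p t1 m1 -> exec m p t2 m2 -> t1 = t2 /\ m1 = m2.
Proof.
move=> H; elim: H t2 m2 => {m p t1 m1}.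
- by move=> m t2 m2 H; inversion H.
- by move=> m a e t2 m2 H; inversion H.
- move=> m m' m'' p q t u _ IHp _ IHq t2 m2 H.
  inversion H as [| |? a ? ? ? b c Hp Hq| | | |]; subst.
  by have [? ?] := IHp _ _ Hp; subst; have [-> ->] := IHq _ _ Hq.
- move=> m m' e p q t /eqP ne _ IH t2 m2 H; inversion H; subst => //.
  by have [-> ->] : t = t0 /\ m' = m2 by exact: IH.
- move=> m m' e p q t e0 _ IH t2 m2 H; inversion H; subst.
    by rewrite e0 in H6.
  by have [-> ->] : t = t0 /\ m' = m2 by exact: IH.
- move=> m m' m'' e p t u /eqP ne _ IHp _ IHw t2 m2 H.
  inversion H; subst => //.
  have [? ?] : t = t0 /\ m' = m'0 by exact: IHp.
  by subst; have [-> ->] : u = u0 /\ m'' = m2 by exact: IHw.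
- move=> m e p e0 t2 m2 H; inversion H; subst => //.
  by rewrite e0 in H2.
Qed.

(* The input occupies the first cells of the memory, all others hold 0.       *)
Definition load_input (s : seq nat) : memory := nth 0 s.

Definition input_size (s : seq nat) : nat := \sum_(x <- s) bitlen x.

(* The number of vertices followed by the adjacency matrix, row by row.       *)
Definition encode_graph (n : nat) (G : sgraph 'I_n) : seq nat :=
  n :: [seq nat_of_bool (G i j) | i <- enum 'I_n, j <- enum 'I_n].

(* Main.v *)
(* A dynamic program over the sets S of vertices already matched: from S, the *)
(* uncovered vertex of largest key is matched with each of its uncovered      *)
(* neighbours.  The sum over the waiting sets S of the number of ways to      *)
(* reach S times the number of perfect matchings avoiding S is invariant.     *)
(* Let A be the larger colour class, B the smaller one, k = n/2.  The keys    *)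
(* are such that A is consumed entirely before B, and such that the           *)
(* neighbourhood of the j vertices of B of smallest degree comes last.  When  *)
(* r vertices of A remain, about r |B| / |E| vertices of B of small degree    *)
(* have all their neighbours among these, so that they cannot have been       *)
(* matched.  Calling delta their number, at most C(|B| - delta, |A| - r)      *)
(* sets occur.  If r >= k/3.55 we bound this by 2^(|B| - delta); otherwise    *)
(* by 2^(3/5 (|B| - delta) + r - delta), since C(N, q) <= (3/2)^N 2^(N - q).  *)
Require Import Defs.
From mathcomp Require Import all_boot all_order all_algebra.
From mathcomp Require Import reals exp.
From mathcomp Require Import zify ring lra.
From Stdlib Require Import FunctionalExtensionality.
Set Implicit Arguments.
Unset Strict Implicit.
Unset Printing Implicit Defensive.

(** * A loop language compiled to the machine *)

(** Let [A] be the larger colour class, [B] the other one, k = n/2 and u = 1/d. Perfect matchings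
    are counted by choosing again and again a partner for the uncovered vertex v of largest key: the
    number of perfect matchings of G - S is the sum of those of G - S - v - w over the uncovered
    neighbours w of v ([pm_avoiding_rec]). A queue in which every covered set S is stored once, with
    the number of ways to reach it, makes this a dynamic program whose time is the number of sets
    that occur, up to a polynomial factor. Everything then depends on the number of these sets,
    which the choice of keys keeps small.

    The sets that occur are [good] ([good_child]). If r vertices of [A] are uncovered, they form a
    set R that depends on r only ([good_uniq_rest]), so that a good set is given by its trace on
    [B], of size |A| - r. The keys postpone the neighbours of vertices of low degree. Let D be the
    set of vertices of [B] with all neighbours in R and delta its size; no vertex of D is covered.
    If D is not all of [B], let b0 be the first vertex outside D in the order by degree. Then R lies
    in the neighbourhood of the at most delta + 1 vertices up to b0, and these have at most the
    average degree of [B]. Hence r |B| <= (delta + 1) |E|, and at most C(|B| - delta, |A| - r) sets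
    occur at this level ([card_good_level]), where |E| <= d k.

    For r >= k/3.55 the number delta is so large that 2^(|B| - delta) is good enough. For smaller r
    nearly all of [A] is covered, the binomial coefficient is far from a central one, and an
    estimate adapted to this case applies ([rate_case_split], [bin_le_rate]). Summation over r gives
    [card_good_le].

    The algorithm is written in a loop language whose compiler comes with bounds on time and on the
    size of numbers ([compile_within], [while_within]). In the main loop a weighted sum over the
    waiting sets that never increases keeps the stored counts below n^n, hence of polynomial length
    ([stepP]); [count_matchings_run] bounds the total time by the number of good sets. *)

Definition narr := 24.

Inductive sexp :=
| XC of nat
| XN
| XIn of sexp
| XA of nat & sexp
| XB of binop & sexp & sexp.

Inductive stmt :=
| SSkip
| SPut of nat & sexp & sexp
| SSeq of stmt & stmt
| SIf of sexp & stmt & stmt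
| SFor of nat & stmt.

Definition store := nat -> nat -> nat.

Definition upd2 (s : store) (j i v : nat) : store :=
  fun j' i' => if (j' == j) && (i' == i) then v else s j' i'.

Fixpoint xwf (e : sexp) : bool :=
  match e with
  | XC _ | XN => true
  | XIn e => xwf e
  | XA j e => (j < narr) && xwf e
  | XB _ a b => xwf a && xwf b
  end.

(* Products are only allowed with the number of vertices, so that one         *)
(* assignment multiplies the largest stored number by O(n).                   *)
Fixpoint linear (e : sexp) : bool :=
  match e with
  | XB Mul a XN => linear a
  | XB Mul _ _ => false
  | XB _ a b => linear a && linear b
  | _ => true
  end.

Fixpoint assigned (j : nat) (p : stmt) : bool :=
  match p with
  | SSkip => false
  | SPut k _ _ => j == k
  | SSeq p q | SIf _ p q => assigned j p || assigned j q
  | SFor k p => (j == k) || assigned j p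
  end.

(** The body of a [SFor] must leave its counter alone, so that it runs exactly [n] times. Only
    assigned values have to be [linear]: indices and tests are not stored. *)
Fixpoint swf (p : stmt) : bool :=
  match p with
  | SSkip => true
  | SPut j a e => [&& j < narr, xwf a, xwf e & linear e]
  | SSeq p q => swf p && swf q
  | SIf e p q => [&& xwf e, swf p & swf q]
  | SFor j p => [&& j < narr, ~~ assigned j p & swf p]
  end.

(** Cell 0 holds [n] and the next [n * n] cells the matrix. Beyond them the arrays are interleaved
    modulo [narr], so that each of them is unbounded. *)
Definition cloc (j : nat) (a : expr) : expr :=
  Bin Add (Bin Add (Bin Mul (Get (Const 0)) (Get (Const 0))) (Const j.+1))
          (Bin Mul a (Const narr)).

Fixpoint cx (e : sexp) : expr :=
  match e with
  | XC c => Const c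
  | XN => Get (Const 0)
  | XIn e => Get (Bin Add (Const 1) (cx e))
  | XA j e => Get (cloc j (cx e))
  | XB o a b => Bin o (cx a) (cx b)
  end.

Fixpoint compile (p : stmt) : prog :=
  match p with
  | SSkip => Skip
  | SPut j a e => Put (cloc j (cx a)) (cx e)
  | SSeq p q => Seq (compile p) (compile q)
  | SIf e p q => If (cx e) (compile p) (compile q)
  | SFor j p =>
      Seq (Put (cloc j (Const 0)) (Const 0))
          (While (cx (XB Defs.Sub XN (XA j (XC 0))))
             (Seq (compile p) (Put (cloc j (Const 0)) (cx (XB Add (XA j (XC 0)) (XC 1))))))
  end.

(** Constants count with their value, which makes [B ^ esize e] a bound on the value of [e] when
    [B >= 2] bounds the memory. These sizes belong to a fixed program, so their magnitude is
    irrelevant. *)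
Fixpoint esize (e : expr) : nat :=
  match e with
  | Const c => c.+1
  | Get a => (esize a).+1
  | Bin _ a b => (esize a + esize b).+1
  end.

Definition put_cost (a e : expr) := esize a ^ 2 + esize e ^ 2 + esize a + esize e.
Definition test_cost (e : expr) := esize e ^ 2 + esize e.

Lemma bitlen_le x l : x < 2 ^ l -> 0 < l -> bitlen x <= l.
Proof.
rewrite /bitlen => xl l0; case: x xl => [|x] xl; first by rewrite trunc_log0.
by rewrite -(@ltn_exp2l 2) //; apply: leq_ltn_trans xl; apply: trunc_logP.
Qed.

Lemma ltn_bitlen x : x < 2 ^ bitlen x.
Proof. exact: trunc_log_ltn. Qed.

Lemma bitlen_mono x y : x <= y -> bitlen x <= bitlen y.
Proof. by move=> xy; rewrite ltnS; apply: leq_trunc_log. Qed.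

Definition bounded (B : nat) (m : memory) := forall a, m a <= B.

Section ExprCost.
Variables (B : nat) (m : memory).
Hypotheses (B_ge2 : 1 < B) (mB : bounded B m).

Lemma esize_gt0 e : 0 < esize e.
Proof. by case: e. Qed.

Lemma eval_le e : eval m e <= B ^ esize e.
Proof.
elim: e => [c|a _|o a IHa b IHb] /=.
- by apply: leq_trans (ltnW (ltn_expl c B_ge2)) _; rewrite leq_pexp2l // ltnW.
- by apply: leq_trans (mB _) _; rewrite -{1}(expn1 B) leq_pexp2l // ltnW.
- have Ba : B ^ esize a <= B ^ (esize a + esize b).+1.
    by rewrite leq_pexp2l ?(ltnW B_ge2) //; lia.
  have B1 k : 0 < B ^ k by rewrite expn_gt0 ltnW.
  have BS : B ^ (esize a + esize b).+1 = B * (B ^ esize a * B ^ esize b).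
    by rewrite expnS expnD.
  case: o => /=.
  + rewrite BS; apply: leq_trans (leq_add IHa IHb) _.
    have := B1 (esize a); have := B1 (esize b).
    move: (B ^ esize a) (B ^ esize b) => x y y0 x0.
    apply: (@leq_trans (2 * (x * y))); first by nia.
    by rewrite leq_mul2r B_ge2 orbT.
  + by apply: leq_trans Ba; apply: leq_trans IHa; exact: leq_subr.
  + rewrite BS; apply: leq_trans (leq_mul IHa IHb) _.
    by apply: leq_pmull; rewrite ltnW.
  + by apply: leq_trans Ba; apply: leq_trans IHa; exact: leq_div.
Qed.

Lemma bitlen_eval e : bitlen (eval m e) <= esize e * bitlen B.
Proof.
apply: bitlen_le; last by rewrite muln_gt0 esize_gt0.
apply: leq_ltn_trans (eval_le e) _.
by rewrite mulnC expnM ltn_exp2r ?esize_gt0 // ltn_bitlen.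
Qed.

Lemma eval_cost_le e : eval_cost m e <= esize e ^ 2 * bitlen B.
Proof.
elim: e => [c|a IHa|o a IHa b IHb].
- have := bitlen_eval (Const c); rewrite /= => /leq_trans; apply.
  by rewrite leq_mul2r; apply/orP; right; rewrite -[X in X <= _]expn1 leq_pexp2l.
- have Ha := bitlen_eval a; have Hm : bitlen (m (eval m a)) <= bitlen B by exact: bitlen_mono.
  rewrite [esize _]/= -[eval_cost _ _]/(eval_cost m a + bitlen (eval m a) + bitlen (m (eval m a))).
  move: IHa Ha Hm; move: (eval_cost _ _) (bitlen _) (bitlen _) (bitlen _) (esize a) => u v w L x.
  rewrite -!mulnn; nia.
- have Ha := bitlen_eval a; have Hb := bitlen_eval b.
  have := bitlen_eval (Bin o a b).
  rewrite [esize (Bin _ _ _)]/= => Ho.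
  rewrite [eval_cost _ _]/= -/(eval m (Bin o a b)).
  move: Ha Hb Ho IHa IHb; set x := esize a; set y := esize b.
  set L := bitlen B; set ea := bitlen _; set eb := bitlen _; set eo := bitlen _.
  rewrite -!mulnn; nia.
Qed.

End ExprCost.

Section Source.
Variables (n : nat) (inp : nat -> nat).

Definition img (s : store) : memory := fun a =>
  if a is x.+1 then
    if x < n * n then inp x else s ((x - n * n) %% narr) ((x - n * n) %/ narr)
  else n.

Fixpoint xev (s : store) (e : sexp) : nat :=
  match e with
  | XC c => c
  | XN => n
  | XIn e => img s (xev s e).+1
  | XA j e => s j (xev s e)
  | XB o a b => binop_eval o (xev s a) (xev s b)
  end.

Fixpoint sem (p : stmt) (s : store) : store :=
  match p with
  | SSkip => s
  | SPut j a e => upd2 s j (xev s a) (xev s e)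
  | SSeq p q => sem q (sem p s)
  | SIf e p q => if xev s e != 0 then sem p s else sem q s
  | SFor j p => iteri n (fun i t => upd2 (sem p t) j 0 i.+1) (upd2 s j 0 0)
  end.

Definition loc (j i : nat) := n * n + j.+1 + i * narr.

Lemma img_loc s j i : j < narr -> img s (loc j i) = s j i.
Proof.
move=> jn; rewrite /loc addnS addSn /= ltnNge -addnA leq_addr /=.
by rewrite addKn addnC modnMDl modn_small // divnMDl // divn_small // addn0.
Qed.

Lemma img_upd2 s j i v : j < narr -> img (upd2 s j i v) = upd (img s) (loc j i) v.
Proof.
move=> jn; apply: functional_extensionality => a; rewrite /upd.
case: eqVneq => [->|ne]; first by rewrite img_loc // /upd2 !eqxx.
case: a ne => [|x] //= ne; case: ltnP => // lx.
rewrite /upd2; case: andP => // -[/eqP ej /eqP ei]; case/eqP: ne.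
rewrite /loc addnS addSn -addnA; congr _.+1.
by rewrite -{1}ej -{1}ei [_ %% _ + _]addnC -divn_eq subnKC.
Qed.

Lemma eval_cloc s j a x : eval (img s) a = x ->
  eval (img s) (cloc j a) = loc j x.
Proof. by move=> /= ->. Qed.

Lemma eval_cx s e : xwf e -> eval (img s) (cx e) = xev s e.
Proof.
elim: e => [c|//|e IH|j e IH|o a IHa b IHb] //= wf.
- by rewrite (IH wf).
- by case/andP: wf => jn wf; rewrite (IH wf) -/(loc j _) img_loc.
- by case/andP: wf => wa wb; rewrite IHa // IHb.
Qed.

Fixpoint xlin (e : sexp) : nat :=
  match e with
  | XC c => c
  | XB Mul a _ => xlin a * n
  | XB Add a b => xlin a + xlin b
  | XB _ a _ => xlin a
  | _ => 1
  end.

Lemma xev_lin B s e : bounded B (img s) -> linear e -> 0 < B ->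
  xwf e -> xev s e <= xlin e * B.
Proof.
move=> sB + B0; elim: e => [c||e _|j e _|o a IHa b IHb] /=.
- by move=> _ _; apply: leq_pmulr.
- by move=> _ _; rewrite mul1n; exact: (sB 0).
- by move=> _ _; rewrite mul1n; exact: (sB (xev s e).+1).
- by move=> _ /andP[jn _]; rewrite mul1n -(img_loc s (xev s e) jn).
case: o => /=.
- case/andP=> la lb /andP[wa wb]; rewrite mulnDl; exact: leq_add (IHa _ _) (IHb _ _).
- case/andP=> la lb /andP[wa wb]; apply: leq_trans (leq_subr _ _) _; exact: IHa.
- case: b IHb => //= _ la /andP[wa _]; rewrite mulnAC leq_mul2r IHa ?orbT //.
- case/andP=> la lb /andP[wa wb]; apply: leq_trans (leq_div _ _) _; exact: IHa.
Qed.

(** The factor by which a run may multiply a bound on the numbers in memory. In a loop the 3 pays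
    for the counter, which becomes [i.+1] after round [i]. *)
Fixpoint growth (p : stmt) : nat :=
  match p with
  | SSkip => 1
  | SPut _ _ e => (xlin e).+1
  | SSeq p q | SIf _ p q => growth p * growth q
  | SFor j p => (growth p * 3) ^ n
  end.

Fixpoint cost (p : stmt) : nat :=
  match p with
  | SSkip => 1
  | SPut j a e => put_cost (cloc j (cx a)) (cx e)
  | SSeq p q => cost p + cost q
  | SIf e p q => test_cost (cx e) + (cost p + cost q)
  | SFor j p =>
      let t := test_cost (cx (XB Defs.Sub XN (XA j (XC 0)))) in
      put_cost (cloc j (Const 0)) (Const 0) +
      (n * (t + (cost p + put_cost (cloc j (Const 0))
                            (cx (XB Add (XA j (XC 0)) (XC 1))))) + t)
  end.

Lemma growth_gt0 p : 0 < growth p.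
Proof.
elim: p => //= [p IHp q IHq|e p IHp q IHq|j p IHp]; rewrite ?muln_gt0 ?IHp ?IHq //.
by rewrite expn_gt0 muln_gt0 IHp.
Qed.

Lemma sem_frame p s j : ~~ assigned j p -> sem p s j = s j.
Proof.
have updE t k i v : j != k -> upd2 t k i v j = t j.
  by move=> jk; apply: functional_extensionality => x; rewrite /upd2 (negbTE jk).
elim: p s => [s|k a e s|p IHp q IHq s|e p IHp q IHq s|k p IH s] //=.
- exact: updE.
- by rewrite negb_or => /andP[jp jq]; rewrite IHq // IHp.
- by rewrite negb_or => /andP[jp jq]; case: ifP => _; [rewrite IHp|rewrite IHq].
- rewrite negb_or => /andP[jk jp].
  set f := fun i t => _; set t := upd2 s k 0 0.
  suff /(_ n) : forall i, iteri i f t j = s j by [].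
  by elim=> [|i IHi] /=; rewrite /f /t updE // IH.
Qed.

Definition halts_within (m : memory) (p : prog) (T : nat) (m' : memory) :=
  exists2 t, exec m p t m' & t <= T.

Lemma bounded_upd B m a v : bounded B m -> v <= B -> bounded B (upd m a v).
Proof. by move=> mB vB x; rewrite /upd; case: ifP. Qed.

Lemma bounded_le B B' m : B <= B' -> bounded B m -> bounded B' m.
Proof. by move=> BB mB x; apply: leq_trans BB. Qed.

Lemma put_within B m a e : 1 < B -> bounded B m ->
  halts_within m (Put a e) (put_cost a e * bitlen B) (upd m (eval m a) (eval m e)).
Proof.
move=> B2 mB; eexists; first exact: ExecPut.
have := eval_cost_le B2 mB a; have := eval_cost_le B2 mB e.
have := bitlen_eval B2 mB a; have := bitlen_eval B2 mB e.
rewrite /put_cost; nia.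
Qed.

Lemma test_within B m e : 1 < B -> bounded B m ->
  eval_cost m e + bitlen (eval m e) <= test_cost e * bitlen B.
Proof.
move=> B2 mB; have := eval_cost_le B2 mB e; have := bitlen_eval B2 mB e.
rewrite /test_cost; nia.
Qed.

Lemma seq_within m p q T U m1 m2 :
  halts_within m p T m1 -> halts_within m1 q U m2 ->
  halts_within m (Seq p q) (T + U) m2.
Proof.
move=> [t e1 t1] [u e2 t2]; exists (t + u); first exact: ExecSeq e1 e2.
exact: leq_add.
Qed.

Lemma within_le m p T U m1 : T <= U -> halts_within m p T m1 -> halts_within m p U m1.
Proof. by move=> TU [t e tT]; exists t => //; apply: leq_trans TU. Qed.

(** During the whole run the memory stays below [B * growth p], so that each test or assignment
    costs a constant times the bit length of this one number; [cost p] adds up the constants. *)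
Lemma compile_within p s B : swf p -> 1 < B -> bounded B (img s) ->
  bounded (B * growth p) (img (sem p s)) /\
  halts_within (img s) (compile p) (cost p * bitlen (B * growth p)) (img (sem p s)).
Proof.
elim: p s B => [s B _ B2 sB|j a e s B|p IHp q IHq s B|e p IHp q IHq s B|j p IH s B].
- split=> /=; first by rewrite muln1.
  exists 1; [exact: ExecSkip|by rewrite mul1n].
- rewrite /= => /and4P[jn wa we le] B2 sB.
  rewrite (img_upd2 _ _ _ jn).
  have B0 : 0 < B by rewrite ltnW.
  have vB := xev_lin sB le B0 we.
  split.
    apply: bounded_upd; first by apply: bounded_le sB; rewrite leq_pmulr.
    by apply: leq_trans vB _; rewrite mulnC leq_mul2l leqnSn orbT.
  rewrite -(eval_cx s we) -(eval_cloc j (eval_cx s wa)).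
  apply: within_le (put_within _ _ B2 sB); rewrite leq_mul2l; apply/orP; right.
  by apply: bitlen_mono; rewrite leq_pmulr.
- rewrite /= => /andP[wp wq] B2 sB.
  have [bp hp] := IHp s B wp B2 sB.
  have B2' : 1 < B * growth p by apply: leq_trans B2 _; rewrite leq_pmulr ?growth_gt0.
  have [bq hq] := IHq (sem p s) _ wq B2' bp.
  rewrite mulnA; split=> //.
  apply: within_le (seq_within hp hq); rewrite mulnDl leq_add2r leq_mul2l.
  by apply/orP; right; apply: bitlen_mono; rewrite leq_pmulr ?growth_gt0.
- rewrite /= => /and3P[we wp wq] B2 sB.
  have [bp [tp ep hp]] := IHp s B wp B2 sB; have [bq [tq eq hq]] := IHq s B wq B2 sB.
  have ht := test_within (cx e) B2 sB.
  have lp : B * growth p <= B * (growth p * growth q).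
    by rewrite mulnA leq_pmulr ?growth_gt0.
  have lq : B * growth q <= B * (growth p * growth q).
    by rewrite mulnCA leq_pmull ?growth_gt0.
  have l0 : B <= B * (growth p * growth q) by rewrite leq_pmulr // muln_gt0 !growth_gt0.
  have := bitlen_mono lp; have := bitlen_mono lq; have := bitlen_mono l0.
  case: ifP => [ne|/negbFE/eqP e0] L0 Lq Lp; (split; first by [exact: bounded_le bp|exact: bounded_le bq]).
  + eexists; first by apply: (ExecIfTrue _ _ ep); rewrite eval_cx.
    move: ht hp; rewrite /test_cost; nia.
  + eexists; first by apply: (ExecIfFalse _ _ eq); rewrite eval_cx.
    move: ht hq; rewrite /test_cost; nia.
- rewrite [swf _]/= => /and3P[jn nj wp] B2 sB.
  set G := growth p * 3; set t := test_cost (cx (XB Defs.Sub XN (XA j (XC 0)))).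
  rewrite [growth _]/= -/G [sem _ _]/=.
  set f := fun i t => _.
  pose s_ i := iteri i f (upd2 s j 0 0).
  have G0 : 0 < G by rewrite muln_gt0 growth_gt0.
  have cnt i : s_ i j 0 = i.
    by case: i => [|i]; rewrite /s_ /= /f /upd2 !eqxx.
  have sG i k : i <= k -> B * G ^ i <= B * G ^ k.
    by move=> ik; rewrite leq_mul2l leq_pexp2l ?orbT.
  have B2' i : 1 < B * G ^ i by apply: leq_trans B2 _; rewrite leq_pmulr // expn_gt0 G0.
  set incr := Put (cloc j (Const 0)) (cx (XB Add (XA j (XC 0)) (XC 1))).
  have step i : bounded (B * G ^ i) (img (s_ i)) ->
     bounded (B * G ^ i.+1) (img (s_ i.+1)) /\
     halts_within (img (s_ i)) (Seq (compile p) incr)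
       ((cost p + put_cost (cloc j (Const 0)) (cx (XB Add (XA j (XC 0)) (XC 1))))
          * bitlen (B * G ^ i.+1)) (img (s_ i.+1)).
    move=> bi; have [bp hp] := IH _ _ wp (B2' i) bi.
    have bpS : bounded (B * G ^ i.+1) (img (sem p (s_ i))).
      by apply: bounded_le bp; rewrite expnS -mulnA leq_mul2l mulnC leq_mul2r leq_pmulr ?orbT.
    have pj : sem p (s_ i) j 0 = i by rewrite sem_frame ?cnt.
    have incrE : upd (img (sem p (s_ i))) (eval (img (sem p (s_ i))) (cloc j (Const 0)))
        (eval (img (sem p (s_ i))) (cx (XB Add (XA j (XC 0)) (XC 1)))) = img (s_ i.+1).
      rewrite (@eval_cloc (sem p (s_ i)) j (Const 0) 0) // eval_cx; last by rewrite /= jn.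
      by rewrite [xev _ _]/= pj addn1 -img_upd2.
    have iB : i.+1 <= B * G ^ i.+1.
      have iG : i <= B * G ^ i by rewrite -{1}(cnt i) -(img_loc _ _ jn).
      have G3 : 3 <= G by rewrite /G leq_pmull // growth_gt0.
      rewrite expnS mulnCA; have := B2' i; move: iG G3; move: (B * G ^ i) => x; nia.
    split.
      by rewrite -incrE; apply: bounded_upd => //; rewrite eval_cx /= ?jn // pj addn1.
    rewrite mulnDl; apply: (@seq_within _ _ _ _ _ (img (sem p (s_ i)))).
      apply: within_le hp; rewrite leq_mul2l; apply/orP; right; apply: bitlen_mono.
      by rewrite expnS -mulnA leq_mul2l mulnC leq_mul2r leq_pmulr ?orbT.
    by rewrite -incrE; apply: put_within.
  have bs i : bounded (B * G ^ i) (img (s_ i)).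
    elim: i => [|i /step[]//].
    by rewrite muln1 /s_ /= img_upd2 //; apply: bounded_upd.
  split; first exact: bs.
  set L := bitlen _; rewrite [compile _]/=.
  set w := While _ _; rewrite [cost _]/= -/t mulnDl.
  have initE : upd (img s) (eval (img s) (cloc j (Const 0))) (eval (img s) (Const 0)) = img (s_ 0).
    by rewrite /s_ /= -img_upd2.
  apply: (@seq_within _ _ _ _ _ (img (s_ 0))).
    rewrite -initE; apply: within_le (put_within _ _ B2 sB).
    by rewrite leq_mul2l; apply/orP; right; apply: bitlen_mono; rewrite leq_pmulr ?expn_gt0 ?G0.
  have tL i : i <= n -> eval_cost (img (s_ i)) (cx (XB Defs.Sub XN (XA j (XC 0)))) +
      bitlen (eval (img (s_ i)) (cx (XB Defs.Sub XN (XA j (XC 0))))) <= t * L.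
    by move=> i_n; apply: test_within; [exact: B2'|apply: bounded_le (bs i); exact: sG].
  have tE i : eval (img (s_ i)) (cx (XB Defs.Sub XN (XA j (XC 0)))) = n - i.
    by rewrite eval_cx /= ?jn // cnt.
  have loop k : k <= n -> halts_within (img (s_ (n - k))) w
     ((k * (t + (cost p + put_cost (cloc j (Const 0)) (cx (XB Add (XA j (XC 0)) (XC 1))))) + t) * L)
     (img (s_ n)).
    elim: k => [_|k IHk kn].
      rewrite subn0; eexists; first by apply: ExecWhileFalse; rewrite tE subnn.
      by rewrite mul0n; apply: tL.
    have [u eu hu] := IHk (ltnW kn).
    have [_ [v ev hv]] := step _ (bs (n - k.+1)).
    have ink : (n - k.+1).+1 = n - k by lia.
    rewrite ink in ev hv.
    eexists.
      by apply: (ExecWhileTrue _ ev eu); rewrite tE; lia.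
    have h1 : n - k.+1 <= n by lia.
    have := tL _ h1.
    have : bitlen (B * G ^ (n - k)) <= L by apply: bitlen_mono; apply: sG; lia.
    move: hu hv; set c := cost p + _; move: (bitlen (B * _)) (_ + bitlen _) => l x.
    nia.
  by have := loop n (leqnn n); rewrite subnn.
Qed.

End Source.

(** * Polynomial bounds in the number of vertices *)

Definition polyb (f : nat -> nat) := exists k, forall n, f n <= (n + 2) ^ k.

(** The base [n + 2] is at least 2, so that its powers exceed any constant even at [n = 0]. *)
Lemma polyb_cst c : polyb (fun=> c).
Proof.
exists c => n; apply: leq_trans (ltnW (ltn_expl c (isT : 1 < 2))) _.
by case: c => // c; rewrite leq_exp2r // leq_addl.
Qed.

Lemma polyb_id : polyb id.
Proof. by exists 1 => n; rewrite expn1 leq_addr. Qed.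

Lemma polyb_le f g : polyb g -> (forall n, f n <= g n) -> polyb f.
Proof. by move=> [k gk] fg; exists k => n; apply: leq_trans (fg n) (gk n). Qed.

Lemma polyb_mul f g : polyb f -> polyb g -> polyb (fun n => f n * g n).
Proof. by move=> [k fk] [l gl]; exists (k + l) => n; rewrite expnD leq_mul. Qed.

Lemma polyb_add f g : polyb f -> polyb g -> polyb (fun n => f n + g n).
Proof.
move=> [k fk] [l gl]; exists (maxn k l).+1 => n; rewrite expnS.
apply: (@leq_trans (2 * (n + 2) ^ maxn k l)); last by rewrite leq_mul2r leq_addl orbT.
rewrite mul2n -addnn; apply: leq_add.
  by apply: leq_trans (fk n) _; rewrite leq_pexp2l ?leq_maxl // addn2.
by apply: leq_trans (gl n) _; rewrite leq_pexp2l ?leq_maxr // addn2.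
Qed.

Lemma polyb_xlin e : polyb (fun n => xlin n e).
Proof.
elim: e => [c||e _|j e _|o a IHa b IHb] /=; try exact: polyb_cst.
case: o => //=; [exact: polyb_add|exact: polyb_mul IHa polyb_id].
Qed.

Lemma polyb_cost p : polyb (fun n => cost n p).
Proof.
elim: p => [|j a e|p IHp q IHq|e p IHp q IHq|j p IH] /=; try exact: polyb_cst.
- exact: polyb_add.
- by apply: polyb_add (polyb_cst _) _; exact: polyb_add.
- apply: polyb_add (polyb_cst _) _; apply: polyb_add _ (polyb_cst _).
  apply: polyb_mul polyb_id _; apply: polyb_add (polyb_cst _) _.
  exact: polyb_add IH (polyb_cst _).
Qed.

(** Raising [2 ^ f n] to the power [n] only multiplies the exponent by [n]: nested loops may create
    huge numbers, but of polynomial bit length. *)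
Lemma polyb_growth p : exists2 f, polyb f & forall n, growth n p <= 2 ^ f n.
Proof.
elim: p => [|j a e|p [f pf Hf] q [g pg Hg]|e p [f pf Hf] q [g pg Hg]|j p [f pf Hf]] /=.
- by exists (fun=> 0); first exact: polyb_cst.
- exists (fun n => (xlin n e).+1).
    apply: (polyb_le (polyb_add (polyb_xlin e) (polyb_cst 1))) => n; by rewrite addn1.
  by move=> n; rewrite ltnW // ltn_expl.
- by exists (fun n => f n + g n); [exact: polyb_add|move=> n; rewrite expnD leq_mul].
- by exists (fun n => f n + g n); [exact: polyb_add|move=> n; rewrite expnD leq_mul].
- exists (fun n => (f n + 2) * n).
    by apply: polyb_mul polyb_id; apply: polyb_add pf (polyb_cst 2).
  move=> n; rewrite expnM; case: n => // n; rewrite leq_exp2r // expnD.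
  exact: leq_mul.
Qed.

(** Over exponentially many rounds the factors [growth n p] would accumulate. Here the invariant [P]
    restores the bound [B] after each round, and the growth is charged for a single round. *)
Lemma while_within n inp B e p (P : store -> Prop) (mu : store -> nat) :
  xwf e -> swf p -> 1 < B ->
  (forall s, P s -> bounded B (img n inp s)) ->
  (forall s, P s -> xev n inp s e != 0 ->
     P (sem n inp p s) /\ mu (sem n inp p s) < mu s) ->
  forall s, P s -> exists s', [/\ P s', xev n inp s' e = 0 &
    halts_within (img n inp s) (While (cx e) (compile p))
      ((mu s).+1 * ((test_cost (cx e) + cost n p) * bitlen (B * growth n p)))
      (img n inp s')].
Proof.
move=> we wp B2 PB Pstep s; have [k] := ubnP (mu s); elim: k s => // k IH s muk Ps.
have le1 : bitlen B <= bitlen (B * growth n p).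
  by apply: bitlen_mono; rewrite leq_pmulr // growth_gt0.
have ht := test_within (cx e) B2 (PB _ Ps).
case: (eqVneq (xev n inp s e) 0) => [e0|ne].
  exists s; split=> //; eexists; first by apply: ExecWhileFalse; rewrite eval_cx.
  apply: leq_trans ht _; apply: leq_trans (leq_pmull _ (ltn0Sn _)); nia.
have [Ps1 lt1] := Pstep _ Ps ne.
have [] := IH _ (leq_trans lt1 muk) Ps1 => s' [Ps' e0' [u eu hu]].
have [_ [v ev hv]] := compile_within wp B2 (PB _ Ps).
exists s'; split=> //; eexists; first by apply: (ExecWhileTrue _ ev eu); rewrite eval_cx.
move: ht hv hu le1 lt1; move: (bitlen B) (bitlen (B * _)) (_ + bitlen _) (test_cost _) (cost n p).
move=> b l x t c; move: (mu s) (mu _) => m1 m0 h1 h2 h3 h4 h5.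
apply: (@leq_trans (t * l + c * l + m1 * ((t + c) * l))); last by rewrite mulSn mulnDl.
apply: leq_add; first by apply: leq_add => //; apply: leq_trans h1 _; rewrite leq_mul2l h4 orbT.
by apply: leq_trans h3 _; rewrite leq_mul2r h5 orbT.
Qed.

(** * Perfect matchings avoiding a set of vertices *)

Section PerfectMatchings.
Variables (V : finType) (G : sgraph V).
Implicit Types (S : {set V}) (M : {set {set V}}).

(** The perfect matchings of the graph with the vertices of [S] deleted; the boolean [v \notin S] is
    read as 1 or 0. *)
Definition pm_avoiding S : {set {set {set V}}} :=
  [set M : {set {set V}} | (M \subset edges G)
     && [forall v : V, #|[set f in M | v \in f]| == (v \notin S)]].

Lemma pm_avoidingP S M : reflect
  (M \subset edges G /\ forall v, #|[set f in M | v \in f]| = (v \notin S))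
  (M \in pm_avoiding S).
Proof.
by rewrite inE; apply: (iffP andP) => -[-> H]; split=> //; [move=> v; apply/eqP; apply: (forallP H)
 | apply/forallP => v; apply/eqP].
Qed.

Lemma pm_avoiding0 : #|pm_avoiding set0| = #|perfect_matchings G|.
Proof. by apply: eq_card => M; rewrite !inE; congr andb; apply: eq_forallb => v; rewrite inE. Qed.

Lemma edgesP (e : {set V}) : reflect (exists v w, G v w /\ e = [set v; w]) (e \in edges G).
Proof.
apply: (iffP imsetP) => [[[v w]]|[v [w [vw ->]]]]; first by rewrite inE /= => vw ->; exists v, w.
by exists (v, w); rewrite ?inE.
Qed.

Lemma pm_avoidingT : #|pm_avoiding setT| = 1.
Proof.
rewrite -(cards1 (set0 : {set {set V}})); apply: eq_card => M; rewrite !inE.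
apply/idP/eqP => [/andP[/subsetP ME /forallP H]|->].
  apply/setP => e; rewrite inE; apply/negP => eM.
  have [v [w [vw ee]]] := edgesP _ (ME _ eM).
  have := H v; rewrite inE cards_eq0 => /eqP/setP/(_ e).
  by rewrite !inE eM ee !inE eqxx.
by rewrite sub0set; apply/forallP => v; rewrite inE cards_eq0; apply/eqP/setP => e; rewrite !inE.
Qed.

(** Removing the edge from a matching and adding it back are inverse bijections. *)
Lemma card_pm_through S v w : G v w -> v \notin S -> w \notin S ->
  #|[set M in pm_avoiding S | [set v; w] \in M]| = #|pm_avoiding (v |: (w |: S))|.
Proof.
move=> vw vS wS; set e := [set v; w].
have nvw : v != w by apply: contraTneq vw => ->; rewrite adj_irr.
have cnt M x : e \notin M ->
    #|[set f in e |: M | x \in f]| = (x \in e) + #|[set f in M | x \in f]|.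
  move=> eM; case xe: (x \in e).
    rewrite (_ : [set f in e |: M | x \in f] = e |: [set f in M | x \in f]).
      by rewrite cardsU1 !inE (negbTE eM).
    by apply/setP => f; rewrite !inE; case: eqVneq => [->|]; rewrite ?xe.
  apply: eq_card => f; rewrite !inE; case: eqVneq => [->|] //=.
  by rewrite xe andbF.
have memE x : (x \notin S) = (x \in e) + (x \notin v |: (w |: S)) :> nat.
  rewrite /e !inE; case: (eqVneq x v) => [->|_] /=; first by rewrite vS.
  by case: (eqVneq x w) => [->|_] /=; rewrite ?wS.
have eN M : M \in pm_avoiding (v |: (w |: S)) -> e \notin M.
  case/pm_avoidingP=> _ /(_ v); rewrite !inE eqxx /= => /eqP; rewrite cards_eq0.
  by move=> /eqP/setP/(_ e); rewrite !inE eqxx /= andbT => ->.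
rewrite -(card_in_imset (f := fun M => e |: M) (D := pm_avoiding (v |: (w |: S)))).
  apply: eq_card => M; rewrite inE.
  apply/andP/imsetP => [[/pm_avoidingP[ME MS] eM]|[M' M'P ->]].
    exists (M :\ e); last by rewrite setD1K.
    apply/pm_avoidingP; split; first exact: subset_trans (subsetDl _ _) ME.
    move=> x; have := MS x; have := cnt (M :\ e) x; rewrite setD1K // !inE eqxx /= => -> //.
    by have := memE x; rewrite !inE => ->; lia.
  have eM' := eN _ M'P; case/pm_avoidingP: M'P => ME MS.
  split; last by rewrite !inE eqxx.
  apply/pm_avoidingP; split.
    rewrite subUset ME andbT sub1set; apply/edgesP; by exists v, w.
  by move=> x; rewrite cnt // MS memE.
move=> M1 M2 /eN e1 /eN e2 /setP E; apply/setP => f; have := E f; rewrite !inE.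
by case: eqVneq => [->|//]; rewrite (negbTE e1) (negbTE e2).
Qed.

(** Exactly one edge of each matching contains [v]; the matchings are sorted by its other end. *)
Lemma pm_avoiding_rec S v : v \notin S ->
  #|pm_avoiding S| = \sum_(w | G v w && (w \notin S)) #|pm_avoiding (v |: (w |: S))|.
Proof.
move=> vS.
transitivity (\sum_(M in pm_avoiding S) \sum_(w | G v w && (w \notin S)) ([set v; w] \in M)).
  rewrite -sum1_card; apply: eq_bigr => M /pm_avoidingP[/subsetP ME MS].
  have := MS v; rewrite vS => /eqP/cards1P[e eE].
  have /setIdP[eM ve] : e \in [set f in M | v \in f] by rewrite eE set11.
  have [w wE vw] : exists2 w, e = [set v; w] & G v w.
    have [a [b [ab ee]]] := edgesP _ (ME _ eM).
    move: ve; rewrite ee !inE => /orP[] /eqP ->; first by exists b.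
    by exists a; [rewrite setUC|rewrite adj_sym].
  have nvw : v != w by apply: contraTneq vw => ->; rewrite adj_irr.
  have wS : w \notin S.
    have : e \in [set f in M | w \in f] by rewrite inE eM wE !inE eqxx orbT.
    by have := MS w; case: (w \in S) => //= /eqP; rewrite cards_eq0 => /eqP ->; rewrite inE.
  rewrite (bigD1 w) ?vw //= -wE eM big1 // => x /andP[/andP[vx xS] xw].
  apply/eqP; rewrite eqb0; apply/negP => exM.
  have : [set v; x] \in [set f in M | v \in f] by rewrite !inE exM eqxx.
  rewrite eE inE wE => /eqP/setP/(_ x); rewrite !inE eqxx orbT (negbTE xw) orbF => /esym/eqP xv.
  by move: vx; rewrite xv adj_irr.
rewrite exchange_big /=; apply: eq_bigr => w /andP[vw wS].
rewrite -card_pm_through // -sum1_card big_mkcond /= [RHS]big_mkcond /=.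
by apply: eq_bigr => M _; rewrite !inE; case: (_ && _) => //=; case: (_ \in _).
Qed.

End PerfectMatchings.

(** * Levels of the dynamic program *)

Section GoodSets.
Variables (V : finType) (G : sgraph V) (A : {set V}) (key rk : V -> nat).
Implicit Types S R X : {set V}.

(* An over-approximation of the sets reached by the dynamic program. *)
Definition good S : bool :=
  [&& [forall a in A :&: S, forall a' in A :\: S, key a' < key a],
      #|S :&: A| == #|S :\: A|
    & [forall b in S :\: A, exists a in A :&: S, G a b]].

Lemma goodP S : reflect
  [/\ forall a a', a \in A -> a \in S -> a' \in A -> a' \notin S -> key a' < key a,
      #|S :&: A| = #|S :\: A|
    & forall b, b \in S -> b \notin A -> exists a, [/\ a \in A, a \in S & G a b]]
  (good S).
Proof.
apply: (iffP and3P) => -[h1 h2 h3]; split.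
- move=> a a' aA aS a'A a'S; move/forallP: h1 => /(_ a); rewrite inE aA aS /=.
  by move=> /forallP/(_ a'); rewrite inE a'S a'A.
- exact/eqP.
- move=> b bS bA; move/forallP: h3 => /(_ b); rewrite inE bA bS /=.
  by case/existsP => a; rewrite inE => /andP[/andP[aA aS] ab]; exists a.
- apply/forallP => a; apply/implyP; rewrite inE => /andP[aA aS].
  apply/forallP => a'; apply/implyP; rewrite inE => /andP[a'S a'A]; exact: h1.
- exact/eqP.
- apply/forallP => b; apply/implyP; rewrite inE => /andP[bA bS].
  by have [a [aA aS ab]] := h3 b bS bA; apply/existsP; exists a; rewrite inE aA aS.
Qed.

Hypothesis bipA : forall v w, G v w -> (v \in A) != (w \in A).

(** The covered part of [A] is a final segment for [key]. Two such segments are nested, hence equal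
    if they have the same size. *)
Lemma good_uniq_rest S1 S2 : good S1 -> good S2 ->
  #|A :\: S1| = #|A :\: S2| -> A :\: S1 = A :\: S2.
Proof.
move=> /goodP[h1 _ _] /goodP[h2 _ _] ec; apply/eqP; rewrite eqEcard ec leqnn andbT.
apply/negPn/negP => /subsetPn[x]; rewrite !inE => /andP[x1 xA]; rewrite xA andbT negbK => x2.
have : ~~ (A :\: S2 \subset A :\: S1).
  apply/negP => s21; have /eqP e12 : A :\: S2 == A :\: S1 by rewrite eqEcard s21 ec leqnn.
  have : x \in A :\: S1 by rewrite inE x1.
  by rewrite -e12 inE x2.
case/subsetPn=> y; rewrite !inE => /andP[y2 yA]; rewrite yA andbT negbK => y1.
by have := h1 y x yA y1 xA x1; have := h2 x y xA x2 yA y2; lia.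
Qed.

Hypothesis rk_inj : injective rk.
Hypothesis rk_deg : forall b b', rk b < rk b' -> degree G b <= degree G b'.
(** Vertices of [A] with larger keys are covered earlier. The condition says that, along the keys,
    the smallest rank of a neighbour never decreases. *)
Hypothesis key_rk : forall a a' b', a \in A -> a' \in A -> key a < key a' ->
  G a' b' -> exists2 b, G a b & rk b <= rk b'.

Let B := ~: A.
Let m := \sum_(b in B) degree G b.

(** An initial segment in the order by degree has at most the average degree: [degree G b0]
    separates the degrees inside [I] from those outside. *)
Lemma initial_degrees b0 (I := [set b in B | rk b <= rk b0]) : b0 \in B ->
  (\sum_(b in I) degree G b) * #|B| <= #|I| * m.
Proof.
move=> b0B.
have IB : I \subset B by apply/subsetP => b; rewrite inE => /andP[].
have lo b : b \in I -> degree G b <= degree G b0.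
  rewrite inE => /andP[_]; rewrite leq_eqVlt => /orP[/eqP/rk_inj ->//|]; exact: rk_deg.
have hi b : b \in B :\: I -> degree G b0 <= degree G b.
  rewrite !inE => /andP[]; case: (b \in A) => //=; rewrite -ltnNge => lb _; exact: rk_deg.
have mE : m = \sum_(b in I) degree G b + \sum_(b in B :\: I) degree G b.
  by rewrite /m (big_setID I) /= (setIidPr IB).
have cE : #|B| = #|I| + #|B :\: I| by rewrite -(cardsID I B) (setIidPr IB).
have hlo : \sum_(b in I) degree G b <= #|I| * degree G b0.
  by rewrite -sum_nat_const; apply: leq_sum.
have hhi : #|B :\: I| * degree G b0 <= \sum_(b in B :\: I) degree G b.
  by rewrite -sum_nat_const; apply: leq_sum.
rewrite mE cE mulnDr [in X in _ <= X]mulnDr mulnC leq_add2l.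
apply: leq_trans (_ : #|I| * (#|B :\: I| * degree G b0) <= _).
  by rewrite mulnCA mulnC leq_mul2l hlo orbT.
by rewrite leq_mul2l hhi orbT.
Qed.

(* The vertices of B whose neighbours are all still uncovered are not covered *)
(* either, and they are numerous because A is consumed starting from the      *)
(* vertices that have no neighbour of small degree.                           *)
Lemma card_good_level r : r <= #|A| ->
  exists delta, [/\ delta <= #|B|, delta = #|B| \/ r * #|B| <= delta.+1 * m
    & #|[set S | good S && (#|A :\: S| == r)]| <= 'C(#|B| - delta, #|A| - r)].
Proof.
move=> rA; case: (set_0Vmem [set S | good S && (#|A :\: S| == r)]) => [->|[S0]].
  by exists #|B|; split; [|left|rewrite cards0].
rewrite inE => /andP[gS0 /eqP rS0].
(* [R] is the uncovered part of [A], the same for all good sets of this level; [D] consists of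
   vertices of [B] that none of them covers. *)
pose R := A :\: S0; pose D := [set b in B | [forall a, G b a ==> (a \in R)]].
have DB : D \subset B by apply/subsetP => b; rewrite inE => /andP[].
have BDE : #|B :\: D| = #|B| - #|D| by rewrite cardsD (setIidPr DB).
exists #|D|; split; first exact: subset_leq_card.
- case: (set_0Vmem (B :\: D)) => [BD0|[b1 b1P]].
    left; apply/eqP; rewrite eqn_leq subset_leq_card //=.
    by rewrite -subn_eq0 -BDE BD0 cards0.
  right.
  (* [b0] has the smallest rank outside [D]. All vertices before it are in [D], which explains
     [.+1], and it has a neighbour [a0] that is already covered. *)
  pose b0 := [arg min_(b < b1 | b \in B :\: D) rk b].
  have [b0P b0min] : b0 \in B :\: D /\ forall b, b \in B :\: D -> rk b0 <= rk b.
    by rewrite /b0; case: arg_minnP.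
  pose I := [set b in B | rk b <= rk b0].
  have b0B : b0 \in B by move: b0P; rewrite inE => /andP[].
  have ID : #|I| <= #|D|.+1.
    have -> : I = b0 |: (I :\ b0) by rewrite setD1K // inE b0B leqnn.
    rewrite cardsU1 !inE eqxx /= add1n ltnS; apply/subset_leq_card/subsetP => b.
    move=> /setD1P[bb0 /setIdP[bB bi]]; apply: contraTT bi => bD.
    rewrite -ltnNge ltn_neqAle; apply/andP; split.
      by apply: contraNneq bb0 => /rk_inj ->.
    by apply: b0min; rewrite inE bD bB.
  have [a0 ba0 a0R] : exists2 a0, G b0 a0 & a0 \notin R.
    move: b0P; rewrite inE => /andP[]; rewrite inE b0B /= => /forallPn[a].
    by rewrite negb_imply => /andP[? ?] _; exists a.
  have a0A : a0 \in A by have := bipA ba0; move: b0B; rewrite inE; case: (b0 \in A); case: (a0 \in A).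
  have a0S : a0 \in S0 by move: a0R; rewrite inE a0A andbT negbK.
  (* As [a0] was covered before every vertex of [R], the order of the keys gives each of them a
     neighbour in [I]; so [R] is contained in the neighbourhood of [I]. *)
  have rI : r <= \sum_(b in I) degree G b.
    rewrite -rS0 -/R.
    apply: (@leq_trans #|\bigcup_(b in I) [set a | G b a]|).
      apply/subset_leq_card/subsetP => a; rewrite inE => /andP[aS aA].
      have [h _ _] := goodP _ gS0.
      have [|b ab bb0] := key_rk aA a0A (h _ _ a0A a0S aA aS) (b' := b0).
        by rewrite adj_sym.
      apply/bigcupP; exists b; last by rewrite inE adj_sym.
      by rewrite !inE bb0 andbT; have := bipA ab; rewrite aA; case: (b \in A).
    elim/big_ind2: _ => [|x1 x2 y1 y2 h1 h2|b _]; rewrite ?cards0 //.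
    by apply: leq_trans (leq_card_setU _ _) _; exact: leq_add.
  apply: leq_trans (_ : #|I| * m <= _); last by rewrite leq_mul2r ID orbT.
  apply: leq_trans (initial_degrees b0B); by rewrite leq_mul2r rI orbT.
(* At a fixed level a good set is determined by its trace on [B]. Each vertex of this trace has a
   covered neighbour, hence lies outside [D]. *)
- rewrite -BDE -cards_draws -(card_in_imset (f := fun S => S :\: A)).
    apply/subset_leq_card/subsetP => X /imsetP[S]; rewrite inE => /andP[gS /eqP rS] ->.
    have RE : A :\: S = R by apply: good_uniq_rest; rewrite ?rS.
    have [_ cS hS] := goodP _ gS.
    have cX : #|S :\: A| = #|A| - r.
      rewrite -cS -rS cardsD [A :&: S]setIC subKn //.
      by apply/subset_leq_card/subsetIr.
    rewrite inE cX eqxx andbT.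
    apply/subsetP => b; rewrite !inE => /andP[bA bS]; rewrite bA /= andbT.
    have [a [aA aS ab]] := hS _ bS bA.
    apply/forallPn; exists a; rewrite negb_imply adj_sym ab /= -RE inE aS //.
  move=> S1 S2; rewrite !inE => /andP[g1 /eqP r1] /andP[g2 /eqP r2] e12.
  have := good_uniq_rest g1 g2; rewrite r1 r2 => /(_ erefl) eR.
  apply/setP => x; case xA : (x \in A).
    by move/setP: eR => /(_ x); rewrite !inE xA !andbT => /negb_inj.
  by move/setP: e12 => /(_ x); rewrite !inE xA.
Qed.

(** Every edge has one end in each class, so [m] is the number of edges, counted equally from both
    sides. *)
Lemma sum_degree_bip : \sum_v degree G v = m * 2.
Proof.
have degE v : degree G v = \sum_w G v w.
  by rewrite /degree -sum1_card big_mkcond /=; apply: eq_bigr => w _; rewrite inE; case: (G v w).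
have restrict (P Q : {set V}) : (forall v w, G v w -> v \in P -> w \in Q) ->
    \sum_(v in P) degree G v = \sum_(v in P) \sum_(w in Q) G v w.
  move=> PQ; apply: eq_bigr => v vP; rewrite degE (bigID (mem Q)) /= [X in _ + X]big1 ?addn0 //.
  by move=> w wQ; case vw: (G v w) => //; rewrite (PQ _ _ vw vP) in wQ.
rewrite (bigID (mem A)) /= (restrict A B); last first.
  by move=> v w /bipA vw vA; move: vw; rewrite vA inE; case: (w \in A).
rewrite exchange_big /= muln2 -addnn; congr (_ + _).
  rewrite /m (restrict B A); last first.
    by move=> v w /bipA; rewrite inE => + vA; rewrite (negbTE vA); case: (w \in A).
  by apply: eq_bigr => b _; apply: eq_bigr => a _; rewrite adj_sym.
by apply: eq_bigl => v; rewrite inE.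
Qed.

End GoodSets.

(** * Two estimates of binomial coefficients *)

Lemma bin_le_3pow N q : 'C(N, q) * 2 ^ (N - q) <= 3 ^ N.
Proof.
case: (leqP q N) => qN; last by rewrite bin_small.
rewrite (_ : 3 = 2 + 1) // expnDn (bigD1 (inord q : 'I_N.+1)) //= inordK //.
by rewrite exp1n muln1 leq_addr.
Qed.

Lemma bin_le_2pow N q : 'C(N, q) <= 2 ^ N.
Proof.
case: (leqP q N) => qN; last by rewrite bin_small.
rewrite (_ : 2 = 1 + 1) // expnDn (bigD1 (inord q : 'I_N.+1)) //= inordK //.
by rewrite !exp1n !muln1 leq_addr.
Qed.

(** * Choosing the order of the vertices *)

(* Names of the arrays; a scalar variable is cell 0 of its array. *)
Notation vS := 0 (only parsing).
Notation vR := 1 (only parsing).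
Notation vU := 2 (only parsing).
Notation vV := 3 (only parsing).
Notation aCol := 4 (only parsing).
Notation aCnt1 := 5 (only parsing).
Notation aCnt2 := 6 (only parsing).
Notation aRk := 7 (only parsing).
Notation aKey := 8 (only parsing).
Notation aPow := 9 (only parsing).
Notation aQueue := 10 (only parsing).
Notation aWays := 11 (only parsing).
Notation aHead := 12 (only parsing).
Notation aTail := 13 (only parsing).
Notation aCur := 14 (only parsing).
Notation aCurWays := 15 (only parsing).
Notation aBest := 16 (only parsing).
Notation aNew := 17 (only parsing).

Definition xvar j := XA j (XC 0).
Definition sset j e := SPut j (XC 0) e.
Definition xadj a b := XIn (XB Add (XB Mul a XN) b).

(** Colours are 1 and 2, and 0 means uncoloured. The product tests at once that the two vertices are
    adjacent and that the first is coloured. *)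
Definition paint : stmt :=
  SIf (XB Mul (xadj (xvar vU) (xvar vV)) (XA aCol (xvar vU)))
    (SPut aCol (xvar vV) (XB Defs.Sub (XC 3) (XA aCol (xvar vU)))) SSkip.

Definition propagate : stmt := SFor vU (SFor vV paint).

Definition coloring : stmt :=
  SFor vS (SSeq
    (SIf (XA aCol (xvar vS)) SSkip (SPut aCol (xvar vS) (XC 1)))
    (SFor vR propagate)).

Definition counting : stmt :=
  SFor vU (SIf (XB Defs.Sub (XA aCol (xvar vU)) (XC 1))
    (sset aCnt2 (XB Add (xvar aCnt2) (XC 1)))
    (sset aCnt1 (XB Add (xvar aCnt1) (XC 1)))).

Definition flipping : stmt :=
  SFor vU (SIf (XB Defs.Sub (xvar aCnt2) (xvar aCnt1))
    (SPut aCol (xvar vU) (XB Defs.Sub (XC 3) (XA aCol (xvar vU)))) SSkip).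

Definition ranking : stmt :=
  SFor vU (SSeq (SPut aRk (xvar vU) (xvar vU))
    (SFor vV (SIf (xadj (xvar vU) (xvar vV))
      (SPut aRk (xvar vU) (XB Add (XA aRk (xvar vU)) XN)) SSkip))).

(** The search for the minimum starts at [n * n + n], above all ranks. The final [+ 2] puts [A]
    above the key 1 of the other class, and the untouched key 0 of the non-vertex [n] is a sentinel
    below both. *)
Definition keying : stmt :=
  SFor vU (SIf (XB Defs.Sub (XC 2) (XA aCol (xvar vU)))
    (SSeq (SPut aKey (xvar vU) (XB Add (XB Mul XN XN) XN))
      (SSeq
        (SFor vV (SIf (xadj (xvar vU) (xvar vV))
          (SIf (XB Defs.Sub (XA aKey (xvar vU)) (XA aRk (xvar vV)))
            (SPut aKey (xvar vU) (XA aRk (xvar vV))) SSkip) SSkip))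
        (SPut aKey (xvar vU)
          (XB Add (XB Add (XB Mul (XA aKey (xvar vU)) XN) (xvar vU)) (XC 2)))))
    (SPut aKey (xvar vU) (XC 1))).

Definition powers : stmt :=
  SSeq (SPut aPow (XC 0) (XC 1))
    (SFor vU (SPut aPow (XB Add (xvar vU) (XC 1))
      (XB Add (XA aPow (xvar vU)) (XA aPow (xvar vU))))).

Definition preprocess : stmt :=
  SSeq coloring (SSeq counting (SSeq flipping (SSeq ranking (SSeq keying (SSeq powers
    (SSeq (SPut aWays (XC 0) (XC 1)) (sset aTail (XC 1)))))))).

Lemma preprocess_wf : swf preprocess. Proof. by []. Qed.

(** The invariant has to be insensitive to the counter, whose value is provided separately as
    [t j 0 = i]. *)
Lemma for_ind n inp (P : nat -> store -> Prop) j p s :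
  ~~ assigned j p ->
  (forall i t v, P i t -> P i (upd2 t j 0 v)) ->
  P 0 s ->
  (forall i t, i < n -> t j 0 = i -> P i t -> P i.+1 (sem n inp p t)) ->
  P n (sem n inp (SFor j p) s).
Proof.
move=> jp Pupd P0 Pstep /=; set f := fun i t => _.
suff H : forall i, i <= n -> P i (iteri i f (upd2 s j 0 0)) /\ iteri i f (upd2 s j 0 0) j 0 = i.
  by have [] := H n (leqnn n).
elim=> [_|i IH lt_in] /=; first by split; [exact: Pupd|rewrite /upd2 !eqxx].
have [Pi ji] := IH (ltnW lt_in).
by split; [apply: Pupd; exact: Pstep|rewrite /f /upd2 !eqxx].
Qed.

Lemma sem_seq n inp p q s : sem n inp (SSeq p q) s = sem n inp q (sem n inp p s).
Proof. by []. Qed.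

Lemma sem_if n inp e p q s :
  sem n inp (SIf e p q) s = if xev n inp s e != 0 then sem n inp p s else sem n inp q s.
Proof. by []. Qed.

Lemma card_ord_ltS n (P : pred 'I_n) (i : 'I_n) :
  #|[set v | P v & v < i.+1]| = P i + #|[set v | P v & v < i]|.
Proof.
have lt (v : 'I_n) : (v < i.+1) = (v == i) || (v < i) by rewrite ltnS leq_eqVlt.
case Pi: (P i).
  rewrite (_ : [set v | P v & v < i.+1] = i |: [set v | P v & v < i]).
    by rewrite cardsU1 inE ltnn andbF.
  by apply/setP => v; rewrite !inE lt; case: eqVneq => [->|] //=; rewrite ?Pi.
by rewrite add0n; apply: eq_card => v; rewrite !inE lt; case: eqVneq => [->|] //=; rewrite ?Pi.
Qed.

Section Preprocess.
Variables (n : nat) (G : sgraph 'I_n) (inp : nat -> nat).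
Hypothesis inpE : forall u v : 'I_n, inp (u * n + v) = G u v.

Lemma img_adj t (u v : 'I_n) : img n inp t (u * n + v).+1 = G u v.
Proof.
rewrite /= inpE ifT //; have := ltn_ord u; have := ltn_ord v; nia.
Qed.

Definition bipartition (A : {set 'I_n}) := forall v w, G v w -> (v \in A) != (w \in A).

Definition partial_coloring (c : nat -> nat) (A : {set 'I_n}) :=
  bipartition A /\ forall v : 'I_n, c v != 0 -> c v = if v \in A then 1 else 2.

Definition supp (c : nat -> nat) : {set 'I_n} := [set v : 'I_n | c v != 0].

(** The coloured vertices form a union of connected components. *)
Definition closed_coloring (c : nat -> nat) :=
  forall u v : 'I_n, G u v -> u \in supp c -> v \in supp c.

Lemma propagateP s A (c := s aCol) (c' := sem n inp propagate s aCol) :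
  partial_coloring c A ->
  [/\ partial_coloring c' A, supp c \subset supp c',
      closed_coloring c -> supp c' \subset supp c
    & forall u v : 'I_n, G u v -> u \in supp c -> v \in supp c'].
Proof.
move=> cA.
pose I (t : store) := [/\ partial_coloring (t aCol) A, supp c \subset supp (t aCol)
  & closed_coloring c -> supp (t aCol) \subset supp c].
have Istep (t : store) (u v : 'I_n) : t vU 0 = u -> t vV 0 = v -> I t ->
    let t' := sem n inp paint t in
    [/\ I t', supp (t aCol) \subset supp (t' aCol)
      & G u v -> u \in supp (t aCol) -> v \in supp (t' aCol)].
  move=> tu tv [[bip tA] ct tc] /=; rewrite tu tv -/(img n inp t (u * n + v).+1) img_adj.
  case Guv: (G u v); last by rewrite mul0n.
  rewrite mul1n; case: (eqVneq (t aCol u) 0) => [u0|une] /=.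
    by split=> //; rewrite inE u0.
  set t' := upd2 _ _ _ _.
  have tE (w : 'I_n) : t' aCol w = if w == v then 3 - t aCol u else t aCol w by [].
  have sub : supp (t aCol) \subset supp (t' aCol).
    apply/subsetP => w; rewrite !inE tE; case: (eqVneq w v) => // _ _.
    by rewrite (tA _ une); case: ifP.
  split=> //; last by rewrite !inE tE eqxx (tA _ une); case: ifP.
  split; last 1 first.
  - move=> cc; apply/subsetP => w; rewrite inE tE; case: (eqVneq w v) => [-> _|_ wn].
      by apply: (cc _ _ Guv); apply: (subsetP (tc cc)); rewrite inE.
    by apply: (subsetP (tc cc)); rewrite inE.
  - split=> // w; rewrite tE; case: (eqVneq w v) => [-> _|_]; last exact: tA.
    by rewrite (tA _ une); have := bip _ _ Guv; case: (u \in A); case: (v \in A).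
  - exact: subset_trans ct sub.
suff [[h1 h2 h3] h4] : I (sem n inp propagate s) /\
    (forall u v : 'I_n, u < n -> G u v -> u \in supp c -> v \in supp c').
  by split=> // u v; exact: h4.
rewrite /c' /propagate; apply: (for_ind (P := fun i t => I t /\
    forall u v : 'I_n, u < i -> G u v -> u \in supp c -> v \in supp (t aCol))) => //.
move=> i t lt_in tu [It Ht]; pose u := Ordinal lt_in.
set t2 := sem _ _ _ _.
suff [[It2 tt2] [_ Hu]] : (I t2 /\ supp (t aCol) \subset supp (t2 aCol)) /\ (t2 vU 0 = i /\
    forall v : 'I_n, v < n -> G u v -> u \in supp c -> v \in supp (t2 aCol)).
  split=> // x y; rewrite ltnS leq_eqVlt => /orP[/eqP xi|xi] xy xc.
    by apply: Hu => //; rewrite (_ : u = x) //; apply: val_inj.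
  by apply: (subsetP tt2); apply: Ht xy xc.
apply: (for_ind (P := fun k t2 => (I t2 /\ supp (t aCol) \subset supp (t2 aCol)) /\ (t2 vU 0 = i /\
    forall v : 'I_n, v < k -> G u v -> u \in supp c -> v \in supp (t2 aCol)))) => //.
move=> k r lt_kn rv [[Ir tr] [ru Hr]]; pose v := Ordinal lt_kn.
have [Ir' rr' Hr'] := Istep r u v ru rv Ir.
split; first by split=> //; exact: subset_trans tr rr'.
split; first by rewrite sem_frame.
move=> x; rewrite ltnS leq_eqVlt => /orP[/eqP xk|xk] ux uc.
  have -> : x = v by apply: val_inj.
  have -> // := Hr'; first by rewrite (_ : v = x) //; apply: val_inj.
  by case: Ir => _ /subsetP cr _; apply: cr.
by apply: (subsetP rr'); exact: Hr.
Qed.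

(** A round that does not lead to a closed colouring colours a new vertex; this can happen at most
    [n] times. *)
Lemma iter_propagateP s A (c := s aCol) (c' := sem n inp (SFor vR propagate) s aCol) :
  partial_coloring c A ->
  [/\ partial_coloring c' A, supp c \subset supp c' & closed_coloring c'].
Proof.
move=> cA.
suff [h1 h2 h3] : [/\ partial_coloring c' A, supp c \subset supp c'
    & closed_coloring c' \/ n <= #|supp c'|].
  split=> //; case: h3 => // h3 u v _ _.
  have /eqP -> : supp c' == setT by rewrite eqEcard subsetT cardsT card_ord.
  by rewrite inE.
apply: (for_ind (P := fun i t => [/\ partial_coloring (t aCol) A, supp c \subset supp (t aCol)
    & closed_coloring (t aCol) \/ i <= #|supp (t aCol)|])) => //.
  by split=> //; right.
move=> i t lt_in _ [tA ct Ht]; have [t'A tt' cl ex] := propagateP tA.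
split=> //; first exact: subset_trans tt'.
move: tt' cl ex; set c1 := t aCol; set c2 := sem _ _ _ _ _ => tt' cl ex.
have clE : supp c2 = supp c1 -> closed_coloring c2.
  by move=> e u v uv; rewrite e => /(ex _ _ uv); rewrite e.
case: Ht => [clt|ilt].
  by left; apply: clE; apply/eqP; rewrite eqEsubset tt' cl.
have [lt|le] := ltnP #|supp c1| #|supp c2|.
  by right; apply: leq_ltn_trans lt.
by left; apply: clE; apply/esym/eqP; rewrite eqEcard tt'.
Qed.

Lemma coloringP (s : store) A : bipartition A -> (forall v : 'I_n, s aCol v = 0) ->
  exists2 A', bipartition A' &
    forall v : 'I_n, sem n inp coloring s aCol v = if v \in A' then 1 else 2.
Proof.
move=> bA s0.
suff [A' [bA' colA] full] : exists2 A', partial_coloring (sem n inp coloring s aCol) A' &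
    closed_coloring (sem n inp coloring s aCol) /\
    forall v : 'I_n, v < n -> v \in supp (sem n inp coloring s aCol).
  exists A' => // v; apply: colA; have [_ /(_ v (ltn_ord v))] := full; by rewrite inE.
apply: (for_ind (P := fun i t => exists2 A', partial_coloring (t aCol) A' &
   closed_coloring (t aCol) /\ forall v : 'I_n, v < i -> v \in supp (t aCol))) => //.
  by exists A; [split=> // v; rewrite s0|split=> // u v _; rewrite inE s0].
move=> i t lt_in ti [A' [bA' tA'] [clt ft]]; pose x := Ordinal lt_in.
set seed := SIf _ _ _.
rewrite -[sem _ _ (SSeq _ _) t]/(sem n inp (SFor vR propagate) (sem n inp seed t)).
set t1 := sem n inp seed t.
have [A'' t1A [tt1 xt1]] : exists2 A'', partial_coloring (t1 aCol) A'' &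
    supp (t aCol) \subset supp (t1 aCol) /\ x \in supp (t1 aCol).
  rewrite /t1 /seed /= ti; case: eqVneq => [x0|xn] /=; last first.
    by exists A' => //; split=> //; rewrite inE.
  set c1 := upd2 _ _ _ _ _.
  have c1E (w : 'I_n) : c1 w = if w == x then 1 else t aCol w by [].
  (* The seed [x] gets colour 1 whatever its class was, so the classes are exchanged on the
     uncoloured vertices if necessary. No edge leaves the coloured part, hence this is again a
     bipartition. *)
  exists [set v | if v \in supp (t aCol) then v \in A' else (v \in A') == (x \in A')].
    split.
      move=> v w vw; rewrite !inE.
      have -> : (t aCol v != 0) = (t aCol w != 0).
        by apply/idP/idP => h; [have := clt v w vw|have := clt w v];
          rewrite !inE; apply; rewrite // adj_sym.
      by have := bA' _ _ vw; case: (v \in A'); case: (w \in A'); case: (x \in A'); case: ifP.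
    move=> v; rewrite c1E; case: (eqVneq v x) => [-> _|_ vn]; last by rewrite !inE vn; exact: tA'.
    by rewrite !inE (x0 : t aCol x = 0) !eqxx.
  split; last by rewrite inE c1E eqxx.
  by apply/subsetP => w; rewrite !inE c1E; case: (eqVneq w x).
have [h1 h2 h3] := iter_propagateP t1A.
exists A'' => //; split=> // v; rewrite ltnS leq_eqVlt => /orP[/eqP vi|vi]; apply: (subsetP h2).
  by rewrite (_ : v = x) //; apply: val_inj.
by apply: (subsetP tt1); exact: ft.
Qed.


Lemma ord_ltS_ind (i : nat) (lt_in : i < n) (P : 'I_n -> Prop) :
  P (Ordinal lt_in) -> (forall v : 'I_n, v < i -> P v) ->
  forall v : 'I_n, v < i.+1 -> P v.
Proof.
move=> Pi Plt v; rewrite ltnS leq_eqVlt => /orP[/eqP vi|]; last exact: Plt.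
by have -> : v = Ordinal lt_in by exact: val_inj.
Qed.

Lemma countingP (s : store) (A : {set 'I_n}) :
  (forall v : 'I_n, s aCol v = if v \in A then 1 else 2) ->
  s aCnt1 0 = 0 -> s aCnt2 0 = 0 ->
  sem n inp counting s aCnt1 0 = #|A| /\ sem n inp counting s aCnt2 0 = #|~: A|.
Proof.
move=> colA c10 c20.
have cE (B : {set 'I_n}) : #|B| = #|[set v | v \in B & v < n]|.
  by apply: eq_card => v; rewrite !inE ltn_ord andbT.
suff [_ [-> ->]] : sem n inp counting s aCol = s aCol /\
    (sem n inp counting s aCnt1 0 = #|[set v | v \in A & v < n]| /\
     sem n inp counting s aCnt2 0 = #|[set v | v \in ~: A & v < n]|) by rewrite -!cE.
apply: (for_ind (P := fun i (t : store) => t aCol = s aCol /\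
    (t aCnt1 0 = #|[set v | v \in A & v < i]| /\
     t aCnt2 0 = #|[set v | v \in ~: A & v < i]|))) => //.
  by rewrite c10 c20; split=> //; split; apply/esym/eqP; rewrite cards_eq0;
    apply/eqP/setP => v; rewrite !inE andbF.
move=> i t lt_in ti [tc [t1 t2]] /=; pose v := Ordinal lt_in.
rewrite ti tc (colA v) (card_ord_ltS (mem A) v) (card_ord_ltS (mem (~: A)) v) !inE -t1 -t2.
by case: (v \in A); rewrite /upd2 /= ?addn1 ?add1n.
Qed.

Lemma flippingP (s : store) (A : {set 'I_n}) : bipartition A ->
  (forall v : 'I_n, s aCol v = if v \in A then 1 else 2) ->
  s aCnt1 0 = #|A| -> s aCnt2 0 = #|~: A| ->
  exists A', [/\ bipartition A', #|~: A'| <= #|A'| &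
    forall v : 'I_n, sem n inp flipping s aCol v = if v \in A' then 1 else 2].
Proof.
move=> bA colA c1 c2.
set F := fun v : 'I_n => if #|A| < #|~: A| then 3 - s aCol v else s aCol v.
have FE (v : 'I_n) : sem n inp flipping s aCol v = F v.
  suff [_ [h _]] : (sem n inp flipping s aCnt1 0 = #|A| /\
      sem n inp flipping s aCnt2 0 = #|~: A|) /\
      ((forall v : 'I_n, v < n -> sem n inp flipping s aCol v = F v) /\
       (forall v : 'I_n, n <= v -> sem n inp flipping s aCol v = s aCol v)) by exact: h.
  apply: (for_ind (P := fun i (t : store) => (t aCnt1 0 = #|A| /\ t aCnt2 0 = #|~: A|) /\
      ((forall v : 'I_n, v < i -> t aCol v = F v) /\
       (forall v : 'I_n, i <= v -> t aCol v = s aCol v)))) => //.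
  move=> i t lt_in ti [[t1 t2] [tF ts]] /=; rewrite ti t1 t2 subn_eq0 -ltnNge.
  rewrite (ts (Ordinal lt_in) (leqnn _)).
  have hi : forall v : 'I_n, i < v -> t aCol v = s aCol v by move=> w /ltnW; exact: ts.
  case: ltnP => lt /=; (split; [by []|split]); rewrite /upd2 /=.
  - apply: ord_ltS_ind => [|w wi]; first by rewrite eqxx /F lt.
    by rewrite ltn_eqF // tF.
  - by move=> w iw; rewrite gtn_eqF // hi.
  - apply: ord_ltS_ind => [|w wi]; last exact: tF.
    by rewrite ts // /F ltnNge lt.
  - exact: hi.
have [lt|le] := ltnP #|A| #|~: A|.
  exists (~: A); split.
  - by move=> v w /bA; rewrite !inE; case: (v \in A); case: (w \in A).
  - by rewrite setCK ltnW.
  - by move=> v; rewrite FE /F lt colA inE; case: (v \in A).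
by exists A; split=> // v; rewrite FE /F ltnNge le colA.
Qed.

(** An injective refinement of the order by degree, ties being broken by the index. *)
Definition rank (v : 'I_n) : nat := v + degree G v * n.

Lemma rankingP (s : store) (v : 'I_n) : sem n inp ranking s aRk v = rank v.
Proof.
suff h : forall v : 'I_n, v < n -> sem n inp ranking s aRk v = rank v by exact: h.
apply: (for_ind (P := fun i (t : store) => forall v : 'I_n, v < i -> t aRk v = rank v)) => //.
move=> i t lt_in ti tF; pose u := Ordinal lt_in.
rewrite sem_seq.
set t1 := sem n inp (SPut _ _ _) t; set t2 := sem n inp (SFor _ _) t1.
suff [_ [tu lo]] : t2 vU 0 = i /\ (t2 aRk i = i + #|[set w | G u w & w < n]| * n /\
    forall v : 'I_n, v < i -> t2 aRk v = rank v).
  apply: ord_ltS_ind => //; rewrite /= tu /rank /degree; congr (_ + _ * _).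
  by apply: eq_card => w; rewrite !inE ltn_ord andbT.
apply: (for_ind (P := fun k (t2 : store) => t2 vU 0 = i /\
   (t2 aRk i = i + #|[set w | G u w & w < k]| * n /\
    forall v : 'I_n, v < i -> t2 aRk v = rank v))) => //.
  split=> //; split.
    rewrite /t1 /= /upd2 /= ti eqxx (_ : [set w | _ & _] = set0) ?cards0 ?addn0 //.
    by apply/setP => w; rewrite !inE andbF.
  by move=> w wi; rewrite /t1 /= /upd2 /= ti ltn_eqF // tF.
move=> k r lt_kn rv [ru [rr rlo]]; pose x := Ordinal lt_kn.
rewrite [sem _ _ _ _]/= ru rv -/(img n inp r (u * n + x).+1) img_adj (card_ord_ltS (G u) x).
case Gux: (G u x) => /=; last by rewrite add0n.
rewrite /upd2 /= eqxx rr ru; split=> //; split.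
  by rewrite -addnA; congr (_ + _); rewrite mulnDl mul1n addnC.
by move=> w wi; rewrite ltn_eqF // rlo.
Qed.

(* Comparing keys of A amounts to comparing first the smallest rank of a       *)
(* neighbour; a vertex without neighbours gets a value above all ranks.       *)
Definition key_spec (A : {set 'I_n}) (v : 'I_n) (x : nat) : Prop :=
  if v \in A then exists k, [/\ x = k * n + v + 2, forall w, G v w -> k <= rank w &
      k = n * n + n \/ exists2 w, G v w & k = rank w]
  else x = 1.

Lemma rank_lt (v : 'I_n) : rank v < n * n + n.
Proof.
have := max_card [set w | G v w]; rewrite card_ord -/(degree G v) /rank.
have := ltn_ord v; nia.
Qed.

Lemma keyingP (s : store) (A : {set 'I_n}) :
  (forall v : 'I_n, s aCol v = if v \in A then 1 else 2) ->
  (forall v : 'I_n, s aRk v = rank v) -> s aKey n = 0 ->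
  (forall v : 'I_n, key_spec A v (sem n inp keying s aKey v)) /\
  sem n inp keying s aKey n = 0.
Proof.
move=> colA rkE key0.
suff [_ [_ [h1 h2]]] : sem n inp keying s aCol = s aCol /\ (sem n inp keying s aRk = s aRk /\
   ((forall v : 'I_n, v < n -> key_spec A v (sem n inp keying s aKey v)) /\
    sem n inp keying s aKey n = 0)) by split=> // v; apply: h1.
apply: (for_ind (P := fun i (t : store) => t aCol = s aCol /\ (t aRk = s aRk /\
   ((forall v : 'I_n, v < i -> key_spec A v (t aKey v)) /\ t aKey n = 0)))) => //.
move=> i t lt_in ti [tc [tr [tF t0]]]; pose u := Ordinal lt_in.
set body := SSeq _ _.
rewrite sem_if (_ : (xev _ _ _ _ != 0) = (u \in A)); last first.
  by rewrite /= ti tc (colA u); case: (u \in A).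
case uA: (u \in A); last first.
  rewrite /= /upd2 /= ti; split=> //; split=> //; split; last by rewrite gtn_eqF.
  apply: ord_ltS_ind => [|w wi]; first by rewrite /= eqxx /key_spec uA.
  by rewrite ltn_eqF //; exact: tF.
rewrite /body !sem_seq.
set scan := SFor vV _.
set t1 := sem n inp (SPut _ _ (XB _ (XB _ _ XN) XN)) t; set t2 := sem n inp scan t1.
have t1E x : t1 aKey x = if x == i then n * n + n else t aKey x by rewrite /t1 /= /upd2 /= ti.
suff [uE [rE [other [cE [lo hi]]]]] : t2 vU 0 = i /\ (t2 aRk = s aRk /\
    ((forall x, x != i -> t2 aKey x = t aKey x) /\ (t2 aCol = s aCol /\
    ((forall w : 'I_n, w < n -> G u w -> t2 aKey i <= rank w) /\
    (t2 aKey i = n * n + n \/ exists2 w, G u w & t2 aKey i = rank w))))).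
  rewrite /= /upd2 /= uE; split=> //; split=> //; split; last by rewrite gtn_eqF // other ?gtn_eqF.
  apply: ord_ltS_ind => [|w wi].
    by rewrite /= eqxx /key_spec uA; exists (t2 aKey i); split=> // w; apply: lo.
  by rewrite ltn_eqF // other ?ltn_eqF //; exact: tF.
apply: (for_ind (P := fun k (t2 : store) => t2 vU 0 = i /\ (t2 aRk = s aRk /\
    ((forall x, x != i -> t2 aKey x = t aKey x) /\ (t2 aCol = s aCol /\
    ((forall w : 'I_n, w < k -> G u w -> t2 aKey i <= rank w) /\
    (t2 aKey i = n * n + n \/ exists2 w, G u w & t2 aKey i = rank w))))))) => //.
  do 2!split=> //; split; first by move=> x xi; rewrite t1E (negbTE xi).
  by do 2!split=> //; left; rewrite t1E eqxx.
move=> k r lt_kn rv [ru [rr [ro [rc [rlo rhi]]]]]; pose v := Ordinal lt_kn.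
rewrite [sem _ _ _ _]/= ru rv -/(img n inp r (u * n + v).+1) img_adj.
case Guv: (G u v); last first.
  do 4!split=> //; split=> //; apply: ord_ltS_ind => //=; by rewrite Guv.
rewrite rr (rkE v) /= subn_eq0 -ltnNge; case: ltnP => lt /=; last first.
  by do 4!split=> //; split=> //; apply: ord_ltS_ind.
rewrite /upd2 /= eqxx; do 2!split=> //; split; first by move=> x xi; rewrite (negbTE xi) ro.
split=> //; rewrite ?ru ?eqxx ?rr ?(rkE v); split; last by right; exists v.
apply: ord_ltS_ind => // w wk uw; apply: leq_trans (ltnW lt) _; exact: rlo.
Qed.

Lemma powersP (s : store) i : i <= n -> sem n inp powers s aPow i = 2 ^ i.
Proof.
suff h : forall i, i <= n -> sem n inp powers s aPow i = 2 ^ i by exact: h.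
rewrite /powers sem_seq.
apply: (for_ind (P := fun k (t : store) => forall i, i <= k -> t aPow i = 2 ^ i)) => //.
  by move=> i0; rewrite leqn0 => /eqP ->.
move=> k t lt_kn tk tE j; rewrite leq_eqVlt ltnS => /orP[/eqP ->|jk].
  by rewrite /= /upd2 /= tk addn1 eqxx tE // addnn -mul2n expnS.
by rewrite /= /upd2 /= tk addn1 ltn_eqF ?ltnS // tE.
Qed.

Definition init_store : store := fun _ _ => 0.

Lemma preprocessP A0 (s := sem n inp preprocess init_store) : bipartition A0 ->
  exists A, [/\ [/\ bipartition A, #|~: A| <= #|A| & forall v, key_spec A v (s aKey v)],
    s aKey n = 0, forall i, i <= n -> s aPow i = 2 ^ i,
    forall i, s aWays i = (i == 0) &
    [/\ s aHead 0 = 0, s aTail 0 = 1 & s aQueue 0 = 0]].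
Proof.
move=> bA0.
set s1 := sem n inp coloring init_store; set s2 := sem n inp counting s1.
set s3 := sem n inp flipping s2; set s4 := sem n inp ranking s3.
set s5 := sem n inp keying s4; set s6 := sem n inp powers s5.
have sE : s = sem n inp (sset aTail (XC 1)) (sem n inp (SPut aWays (XC 0) (XC 1)) s6) by [].
have [A1 bA1 c1] := coloringP (s := init_store) bA0 (fun=> erefl).
have [k1 k2] : s2 aCnt1 0 = #|A1| /\ s2 aCnt2 0 = #|~: A1|.
  by apply: countingP => //; rewrite /s1 sem_frame.
have [A [bA leA c3]] : exists A', [/\ bipartition A', #|~: A'| <= #|A'| &
    forall v : 'I_n, s3 aCol v = if v \in A' then 1 else 2].
  by apply: flippingP bA1 _ k1 k2 => v; rewrite /s2 sem_frame // c1.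
have c4 (v : 'I_n) : s4 aCol v = if v \in A then 1 else 2 by rewrite /s4 sem_frame // c3.
have key4 : s4 aKey n = 0 by rewrite /s4 /s3 /s2 /s1 !sem_frame.
have [key5 key5n] := keyingP c4 (rankingP s3) key4.
exists A; split.
- split=> // v; rewrite sE /= /upd2 /=; rewrite /s6 sem_frame //; exact: key5.
- by rewrite sE /= /upd2 /= /s6 sem_frame // key5n.
- by move=> i i_n; rewrite sE /= /upd2 /= /s6 powersP.
- move=> i; rewrite sE /= /upd2 /=; case: eqVneq => // _.
  by rewrite /s6 /s5 /s4 /s3 /s2 /s1 !sem_frame.
- by split; rewrite sE /= /upd2 //= /s6 /s5 /s4 /s3 /s2 /s1 !sem_frame.
Qed.

End Preprocess.

(** * The dynamic program *)

Section Encoding.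
Variable n : nat.
Implicit Types S T : {set 'I_n}.

Definition enc S := \sum_(i in S) 2 ^ i.

Lemma sum_pow2 k : \sum_(i < k) 2 ^ i = 2 ^ k - 1.
Proof.
elim: k => [|k IH]; first by rewrite big_ord0.
by rewrite big_ord_recr /= IH expnS; have := expn_gt0 2 k; lia.
Qed.

Lemma enc_low S k : k <= n -> \sum_(i in S | i < k) 2 ^ i < 2 ^ k.
Proof.
move=> kn; apply: (@leq_ltn_trans (\sum_(i < k) 2 ^ i)).
  rewrite (big_ord_widen n (fun i => 2 ^ i) kn) big_mkcond [X in _ <= X]big_mkcond /=.
  by apply: leq_sum => i _; case: (i \in S); case: (i < k).
by rewrite sum_pow2; have := expn_gt0 2 k; lia.
Qed.

Lemma enc_lt S : enc S < 2 ^ n.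
Proof.
rewrite /enc (eq_bigl (fun i => (i \in S) && (i < n))) ?enc_low // => i.
by rewrite ltn_ord andbT.
Qed.

Lemma encT : enc setT = 2 ^ n - 1.
Proof. by rewrite -sum_pow2; apply: eq_bigl => i; rewrite inE. Qed.

Lemma enc_bit S (v : 'I_n) : let q := enc S %/ 2 ^ v in q - q %/ 2 * 2 = (v \in S).
Proof.
have -> : enc S = \sum_(i in S | i < v) 2 ^ i + ((v \in S) + 2 * (\sum_(i in S | v < i) 2 ^ (i - v.+1))) * 2 ^ v.
  rewrite /enc (bigID (fun i : 'I_n => i < v)) /=; congr (_ + _).
  rewrite (bigID (pred1 v)) /= mulnDl; congr (_ + _).
    case vS: (v \in S); last first.
      by rewrite big_pred0 // => i /=; case: (eqVneq i v) => [->|_]; rewrite ?vS ?andbF.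
    rewrite (big_pred1 v) ?mul1n // => i.
    by rewrite /=; case: (eqVneq i v) => [->|_]; rewrite ?vS ?ltnn ?andbF.
  rewrite mulnAC big_distrr /=; apply: eq_big => [i|i].
    by rewrite -andbA -leqNgt -val_eqE /= ltn_neqAle [_ && (v <= i)]andbC eq_sym.
  move=> /andP[/andP[_ h1] h2]; rewrite -expnS -expnD; congr (_ ^ _).
  by move: h1 h2; rewrite -val_eqE /=; lia.
have lo := enc_low S (ltnW (ltn_ord v)).
rewrite divnDMl ?expn_gt0 // divn_small // add0n mulnC /=.
move: (\sum_(_ in _ | _) 2 ^ (_ - _)) => x; rewrite divnDMl // ?[_ * 2]mulnC.
by rewrite divn_small ?add0n //; case: (v \in S); lia.
Qed.

Lemma enc_inj : injective enc.
Proof.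
move=> S T e; apply/setP => v; move: (enc_bit S v) (enc_bit T v); rewrite /= e => ->.
by case: (v \in S); case: (v \in T).
Qed.

Lemma enc_child S v w : v \notin S -> w \notin S -> v != w ->
  enc (v |: (w |: S)) = enc S + 2 ^ v + 2 ^ w.
Proof.
move=> vS wS vw; rewrite /enc !big_setU1 //=; last by rewrite !inE negb_or vw.
by rewrite addnC -addnA addnC; lia.
Qed.

End Encoding.

(** The parity of a quotient, spelled out because the machine has no remainder operation. *)
Definition xbit : sexp :=
  let q := XB Div (xvar aCur) (XA aPow (xvar vV)) in
  XB Defs.Sub q (XB Mul (XB Div q (XC 2)) (XC 2)).

Definition select : stmt :=
  SFor vV (SIf xbit SSkip
    (SIf (XB Defs.Sub (XA aKey (xvar vV)) (XA aKey (xvar aBest)))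
      (sset aBest (xvar vV)) SSkip)).

(** [aWays] is indexed by the codes of the sets, which costs exponential space and makes a lookup a
    single access. A zero entry marks a set that was never queued. *)
Definition push : stmt :=
  SSeq (sset aNew (XB Add (XB Add (xvar aCur) (XA aPow (xvar aBest))) (XA aPow (xvar vV))))
  (SSeq (SIf (XA aWays (xvar aNew)) SSkip
          (SSeq (SPut aQueue (xvar aTail) (xvar aNew))
                (sset aTail (XB Add (xvar aTail) (XC 1)))))
        (SPut aWays (xvar aNew) (XB Add (XA aWays (xvar aNew)) (xvar aCurWays)))).

Definition extend : stmt :=
  SFor vV (SIf xbit SSkip (SIf (xadj (xvar aBest) (xvar vV)) push SSkip)).

Definition pop : stmt :=
  SSeq (sset aCur (XA aQueue (xvar aHead)))
  (SSeq (sset aCurWays (XA aWays (xvar aCur)))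
  (SSeq (sset aHead (XB Add (xvar aHead) (XC 1)))
        (sset aBest XN))).

Definition step : stmt := SSeq pop (SSeq select extend).

Lemma step_wf : swf step. Proof. by []. Qed.

Lemma for_var n inp j p s i : ~~ assigned j p ->
  sem n inp (SFor j p) s j i = if i == 0 then n else s j i.
Proof.
move=> jp /=; set f := fun i t => _.
suff /(_ n) : forall k, iteri k f (upd2 s j 0 0) j i = if i == 0 then k else s j i by [].
by elim=> [|k IH] /=; rewrite /upd2 /f ?eqxx /=; case: eqP => // i0; rewrite /upd2 /=
  ?eqxx /= ?sem_frame ?IH //; case: eqP i0.
Qed.

Section Push.
Variables (n : nat) (inp : nat -> nat) (t : store).
Let t' := sem n inp push t.
Let x := t aCur 0 + t aPow (t aBest 0) + t aPow (t vV 0).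

Lemma push_tail : t' aTail 0 = t aTail 0 + (t aWays x == 0).
Proof. by rewrite /t' /= -/x; case: eqVneq => e /=; rewrite ?addn0 ?addn1. Qed.

Lemma push_queue i :
  t' aQueue i = if (t aWays x == 0) && (i == t aTail 0) then x else t aQueue i.
Proof. by rewrite /t' /= -/x; case: (eqVneq (t aWays x) 0) => e /=. Qed.

Lemma push_ways y :
  t' aWays y = if y == x then t aWays x + t aCurWays 0 else t aWays y.
Proof. by rewrite /t' /= -/x; case: (eqVneq (t aWays x) 0) => e /=. Qed.

Lemma push_new i : t' aNew i = if i == 0 then x else t aNew i.
Proof. by rewrite /t' /= -/x; case: (eqVneq (t aWays x) 0) => e /=. Qed.

Lemma push_tail_other i : i != 0 -> t' aTail i = t aTail i.
Proof.
by rewrite /t' /= -/x => i0; case: (eqVneq (t aWays x) 0) => e /=; rewrite /upd2 /= ?(negbTE i0).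
Qed.

End Push.

Lemma sum_ord_ltS n (P : pred 'I_n) (F : 'I_n -> nat) (w : 'I_n) :
  \sum_(i | P i && (i < w.+1)) F i = P w * F w + \sum_(i | P i && (i < w)) F i.
Proof.
rewrite (bigID (pred1 w)) /=; congr (_ + _).
  case Pw: (P w); last first.
    by rewrite big_pred0 // => i; case: (eqVneq i w) => [->|_]; rewrite ?Pw ?andbF.
  rewrite (big_pred1 w) ?mul1n // => i.
  by rewrite /=; case: (eqVneq i w) => [->|_]; rewrite ?Pw ?ltnS ?leqnn ?andbF.
apply: eq_bigl => i; rewrite ltnS leq_eqVlt -andbA; congr (_ && _).
by rewrite -val_eqE /=; case: ltngtP.
Qed.

Lemma sum_update_seq (T : eqType) (r : seq T) (g om : T -> nat) x c :
  uniq r -> x \in r ->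
  \sum_(y <- r) (if y == x then g x + c else g y) * om y
    = \sum_(y <- r) g y * om y + c * om x.
Proof.
move=> ur xr; rewrite !(bigD1_seq x) //= eqxx mulnDl addnAC; congr (_ + _ + _).
by apply: eq_bigr => y /negbTE ->.
Qed.

Section DynamicProgram.
Variables (n : nat) (G : sgraph 'I_n) (inp : nat -> nat) (A : {set 'I_n}) (key : nat -> nat).
Hypothesis inpE : forall u v : 'I_n, inp (u * n + v) = G u v.
Hypothesis bipA : bipartition G A.
Hypothesis BA : #|~: A| <= #|A|.
Hypothesis keyP : forall v : 'I_n, key_spec G A v (key v).
Hypothesis key_n : key n = 0.
Implicit Types S T : {set 'I_n}.

Let vkey (v : 'I_n) := key v.
Local Notation good := (good G A vkey).

Lemma key_gt0 (v : 'I_n) : 0 < key v.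
Proof. by have := keyP v; rewrite /key_spec; case: ifP => [_ [k [-> _ _]]|_ ->]; lia. Qed.

Lemma key_out (v : 'I_n) : (key v <= 1) = (v \notin A).
Proof. by have := keyP v; rewrite /key_spec; case: ifP => [_ [k [-> _ _]]|_ ->] //; lia. Qed.

Lemma key_inj : {in A &, injective vkey}.
Proof.
move=> a b aA bA; have := keyP a; have := keyP b; rewrite /key_spec aA bA /vkey.
move=> [k [-> _ _]] [l [-> _ _]] e; apply: val_inj => /=.
move: e (ltn_ord a) (ltn_ord b); case: (ltngtP k l) => [kl|lk|->]; last by lia.
  by have := leq_mul kl (leqnn n); rewrite mulSn; lia.
by have := leq_mul lk (leqnn n); rewrite mulSn; lia.
Qed.

(** As indices are below [n], keys are compared first by the least rank of a neighbour. If [a] had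
    no neighbour, its key would use a value above the rank of [b']. *)
Lemma key_rank a a' b' : a \in A -> a' \in A -> vkey a < vkey a' -> G a' b' ->
  exists2 b, G a b & rank G b <= rank G b'.
Proof.
move=> aA aA' + ab'; have := keyP a; have := keyP a'; rewrite /key_spec aA aA' /vkey.
move=> [k' [-> h' _]] [k [-> h e]] lt.
have kk' : k <= k'.
  rewrite leqNgt; apply/negP => k'k; have := leq_mul k'k (leqnn n).
  by have := ltn_ord a; have := ltn_ord a'; rewrite mulSn; lia.
have kr := leq_trans kk' (h' _ ab').
case: e kr => [->|[b ab ->]] kr; last by exists b.
by have := rank_lt G b'; rewrite ltnNge kr.
Qed.

Lemma good0 : good set0.
Proof.
apply/goodP; split; [by move=> a a' _; rewrite inE|by rewrite set0I set0D|].
by move=> b; rewrite inE.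
Qed.

Definition next S (v : 'I_n) :=
  v \notin S /\ forall w : 'I_n, w \notin S -> key w <= key v.

(** The point is that [v] lies in [A]. Otherwise its key 1 is maximal among the uncovered vertices,
    so [A] is entirely covered; then as many vertices of the smaller class are covered, that is all
    of them, including [v]. *)
Lemma good_child S v w : good S -> next S v -> G v w -> w \notin S ->
  good (v |: (w |: S)).
Proof.
move=> /goodP[g1 g2 g3] [vS vmax] vw wS.
have vA : v \in A.
  apply: contraNT vS => vA.
  have AS : A \subset S.
    apply/subsetP => a aA; apply/negPn/negP => aS; have := vmax _ aS.
    move: vA; rewrite -key_out => v1 /leq_trans/(_ v1); by rewrite key_out aA.
  have : S :\: A == ~: A.
    rewrite eqEcard -g2 (setIidPr AS) BA andbT.
    by apply/subsetP => x; rewrite !inE => /andP[].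
  by move=> /eqP/setP/(_ v); rewrite !inE vA /=.
have wA : w \notin A by have := bipA vw; rewrite vA; case: (w \in A).
apply/goodP; split.
- move=> a a' aA; rewrite !inE => /or3P[/eqP av|/eqP aw|aS] a'A; rewrite !negb_or => /and3P[a'v a'w a'S].
  + rewrite av ltn_neqAle vmax // andbT; apply: contraNneq a'v => /key_inj -> //.
  + by rewrite aw (negbTE wA) in aA.
  + exact: g1.
- have -> : (v |: (w |: S)) :&: A = v |: (S :&: A).
    apply/setP => x; rewrite !inE; case: (eqVneq x v) => [->|_] /=; rewrite ?vA //.
    by case: (eqVneq x w) => [->|_] /=; rewrite ?(negbTE wA) ?andbF.
  have -> : (v |: (w |: S)) :\: A = w |: (S :\: A).
    apply/setP => x; rewrite !inE; case: (eqVneq x w) => [->|_] /=; rewrite ?wA ?orbT //.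
    by case: (eqVneq x v) => [->|_] /=; rewrite ?vA ?(negbTE vS).
  by rewrite !cardsU1 g2 !inE (negbTE vS) (negbTE wS) andbF.
- move=> b; rewrite !inE => /or3P[/eqP ->|/eqP ->|bS] bA.
  + by rewrite vA in bA.
  + by exists v; rewrite !inE eqxx.
  + by have [a [aA aS ab]] := g3 _ bS bA; exists a; rewrite !inE aS !orbT.
Qed.

Lemma card_child S v w : v \notin S -> G v w -> w \notin S -> #|v |: (w |: S)| = #|S|.+2.
Proof.
move=> vS vw wS; rewrite !cardsU1 wS !inE (negbTE vS).
by case: eqVneq vw => [->|]; rewrite ?adj_irr.
Qed.

Definition fixed (t : store) := t aKey = key /\ forall i, i <= n -> t aPow i = 2 ^ i.

Lemma xbitE t S (v : 'I_n) : fixed t -> t aCur 0 = enc S -> t vV 0 = v ->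
  xev n inp t xbit = (v \in S).
Proof. by move=> [_ tp] tc tv; rewrite /= tc tv tp ?(ltnW (ltn_ord v)) // enc_bit. Qed.

Lemma selectP s S M : fixed s -> s aCur 0 = enc S -> s aBest 0 = n ->
  (forall i, s aBest i <= M) -> n <= M ->
  (forall i, sem n inp select s aBest i <= M) /\
  (sem n inp select s aBest 0 = n /\ S = setT \/
   exists2 v : 'I_n, sem n inp select s aBest 0 = v & next S v).
Proof.
move=> fs sc sb sM nM.
suff [_ [_ [h1 h2]]] : fixed (sem n inp select s) /\ (sem n inp select s aCur 0 = enc S /\
  ((forall i, sem n inp select s aBest i <= M) /\
   (sem n inp select s aBest 0 = n /\ (forall w : 'I_n, w < n -> w \in S) \/
    exists2 v : 'I_n, sem n inp select s aBest 0 = v &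
      v \notin S /\ forall w : 'I_n, w < n -> w \notin S -> key w <= key v))).
  split=> //; case: h2 => [[h2 h3]|[v h2 [h3 h4]]]; [left|right].
    by split=> //; apply/setP => w; rewrite inE h3.
  by exists v => //; split=> // w; apply: h4.
apply: (for_ind (P := fun k (t : store) => fixed t /\ (t aCur 0 = enc S /\
  ((forall i, t aBest i <= M) /\
   (t aBest 0 = n /\ (forall w : 'I_n, w < k -> w \in S) \/
    exists2 v : 'I_n, t aBest 0 = v &
      v \notin S /\ forall w : 'I_n, w < k -> w \notin S -> key w <= key v))))) => //.
  by do 3!split=> //; left.
move=> k t lt_kn tv [ft [tc [tM tb]]]; pose w := Ordinal lt_kn.
rewrite sem_if (xbitE (v := w) ft tc tv).
case wS: (w \in S) => /=.
  do 3!split=> //; case: tb => [[h1 h2]|[v h1 [h2 h3]]]; [left|right].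
    by split=> //; apply: ord_ltS_ind.
  by exists v => //; split=> //; apply: ord_ltS_ind => //; rewrite wS.
have ftk := ft.1; rewrite ftk tv subn_eq0 -ltnNge.
case: ltnP => lt /=.
  split; first exact: ft.
  split; first exact: tc.
  split.
    by move=> i; rewrite /upd2 /=; case: eqP => // _; apply: leq_trans (ltnW lt_kn) nM.
  right; exists w => //; split; first by rewrite wS.
  apply: ord_ltS_ind => // x xk xS; apply: leq_trans (_ : key (t aBest 0) <= _); last exact: ltnW.
  case: tb => [[_ h]|[v -> [_ h]]]; last exact: h.
  by rewrite h in xS.
do 3!split=> //; right; case: tb => [[h1 h2]|[v h1 [h2 h3]]].
  by move: lt; rewrite h1 key_n leqn0 => /eqP k0; have := key_gt0 w; rewrite (k0 : key w = 0).
by exists v => //; split=> //; apply: ord_ltS_ind => // _; rewrite -h1.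
Qed.

Definition queue_state (s : store) (qs : seq {set 'I_n}) :=
  [/\ s aTail 0 = size qs,
      forall i, i < size qs -> s aQueue i = enc (nth set0 qs i),
      uniq qs /\ (forall T, T \in qs -> good T),
      forall T, (s aWays (enc T) != 0) = (T \in qs)
    & forall i j, i <= j -> j < size qs -> #|nth set0 qs i| <= #|nth set0 qs j|].

(** A weighted count over the waiting sets. With the weight [pm] it keeps the answer, up to the full
    set; with [weight] it bounds the stored numbers. *)
Definition potential (s : store) (qs : seq {set 'I_n}) h (om : {set 'I_n} -> nat) :=
  \sum_(T <- drop h qs) s aWays (enc T) * om T.

Definition children S v (k : nat) : pred 'I_n := fun w => (G v w && (w \notin S)) && (w < k).

(** The situation after [k] rounds of [extend]: the processed part of the queue is untouched, and
    the potential has gained the children met so far, each with the multiplicity of [S]. The weight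
    [om] is arbitrary, in order to be used twice. *)
Definition extended (s : store) S (v : 'I_n) (qs : seq {set 'I_n}) h k (t : store) qs' :=
  [/\ [/\ fixed t, t aCur 0 = enc S, t aBest 0 = v & t aCurWays 0 = s aCurWays 0],
      [/\ queue_state t qs', take h.+1 qs' = take h.+1 qs, h < size qs'
        & forall T, T \in qs' -> #|T| <= #|S|.+2],
      forall om, potential t qs' h.+1 om = potential s qs h.+1 om
        + s aCurWays 0 * \sum_(w | children S v k w) om (v |: (w |: S)),
      (forall T, T \in take h.+1 qs -> t aWays (enc T) = s aWays (enc T)) /\
      (forall x, t aWays x = s aWays x \/ exists2 T, T \in drop h.+1 qs' & x = enc T)
    & [/\ forall i, t aQueue i = s aQueue i \/ t aQueue i < 2 ^ n,
          forall i, t aNew i = s aNew i \/ t aNew i < 2 ^ n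
        & forall i, i != 0 -> t aTail i = s aTail i]].

Lemma extendP s S (v : 'I_n) qs h (t := sem n inp extend s) :
  fixed s -> s aCur 0 = enc S -> s aBest 0 = v -> next S v -> s aCurWays 0 != 0 ->
  queue_state s qs -> h < size qs -> nth set0 qs h = S ->
  (forall T, T \in qs -> #|T| <= #|S|.+2) ->
  exists qs', extended s S v qs h n t qs'.
Proof.
move=> fs sc sb vnext c0 sqs hqs qsh qsS; have [vS _] := vnext.
apply: (for_ind (P := fun k t => exists qs', extended s S v qs h k t qs')) => //.
  exists qs; split=> //.
  - move=> om; rewrite big_pred0 ?muln0 ?addn0 // => w; by rewrite /children andbF.
  - by split=> // x; left.
  - by split=> // i; left.
move=> k {}t lt_kn tv [qs' [[ft tc tb tw] [tqs tk hq' qS'] pot [keep dom] [bq bn bt]]].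
pose w := Ordinal lt_kn.
have sumE om : \sum_(x | children S v k.+1 x) om (v |: (x |: S)) =
    (G v w && (w \notin S)) * om (v |: (w |: S)) + \sum_(x | children S v k x) om (v |: (x |: S)).
  exact: (@sum_ord_ltS n (fun x => G v x && (x \notin S)) (fun x => om (v |: (x |: S))) w).
rewrite sem_if (_ : (xev _ _ _ _ != 0) = (w \in S)); last first.
  by rewrite (xbitE (v := w) ft tc tv); case: (w \in S).
case wS: (w \in S).
  by exists qs'; split=> // om; rewrite sumE wS andbF mul0n add0n.
rewrite sem_if (_ : (xev _ _ _ _ != 0) = G v w); last first.
  rewrite -[xev _ _ _ _]/(img n inp t (t aBest 0 * n + t vV 0).+1) tb tv.
  by rewrite (img_adj inpE t v w); case: (G v w).
case vw: (G v w); last first.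
  by exists qs'; split=> // om; rewrite sumE vw mul0n add0n.
move/negbT in wS.
have nvw : v != w by apply: contraTneq vw => ->; rewrite adj_irr.
set t' := sem n inp push t.
set S' := v |: (w |: S).
have xE : t aCur 0 + t aPow (t aBest 0) + t aPow (t vV 0) = enc S'.
  by rewrite tc tb tv !(ft.2) ?(ltnW (ltn_ord v)) ?(ltnW lt_kn) // enc_child.
have t'tail := push_tail n inp t; have t'queue := push_queue n inp t.
have t'ways := push_ways n inp t; have t'new := push_new n inp t.
have t'tl := push_tail_other n inp t.
move: t'tail t'queue t'ways t'new t'tl; rewrite !xE -/t' => t'tail t'queue t'ways t'new t'tl.
have [q1 q2 [q3 q4] q5 q6] := tqs.
have sS' : #|S'| = #|S|.+2 by exact: card_child.
have S0E : nth set0 qs' h = S by rewrite -(nth_take set0 (ltnSn h)) tk nth_take.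
(* The queue is sorted by cardinality and the child has two elements more than [S]: it is not among
   the processed sets, and its count may still grow. *)
have S'take : S' \notin take h.+1 qs'.
  apply/negP => /(nthP set0)[i]; rewrite size_takel // => ih.
  rewrite nth_take // => e; have := q6 i h ih hq'; rewrite e S0E sS'; lia.
have w'E T : t' aWays (enc T) = if T == S' then t aWays (enc S') + s aCurWays 0 else t aWays (enc T).
  by rewrite t'ways (inj_eq (@enc_inj n)) tw.
have [gS gS'] : good S /\ good S'.
  have gS : good S by rewrite -S0E q4 // mem_nth.
  by split=> //; exact: good_child.
exists (if S' \in qs' then qs' else rcons qs' S').
have t0E : (t aWays (enc S') == 0) = (S' \notin qs') by rewrite -q5 negbK.
have take' : take h.+1 (if S' \in qs' then qs' else rcons qs' S') = take h.+1 qs'.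
  by case: ifP => // _; rewrite -cats1 takel_cat.
have drop' : S' \in drop h.+1 (if S' \in qs' then qs' else rcons qs' S').
  case: ifP => [S'q|_].
    by move: S'q; rewrite -{1}(cat_take_drop h.+1 qs') mem_cat (negbTE S'take).
  by rewrite drop_rcons // mem_rcons inE eqxx.
have dropsub T : T \in drop h.+1 qs' -> T \in drop h.+1 (if S' \in qs' then qs' else rcons qs' S').
  by case: ifP => // _; rewrite drop_rcons // mem_rcons inE orbC => ->.
split.
- by split; [rewrite /fixed|..]; rewrite /t' !sem_frame.
- rewrite take' tk; split=> //; last first.
  + by move=> T; case: ifP => _; [exact: qS'|rewrite mem_rcons inE => /orP[/eqP ->|/qS' //]; rewrite sS'].
  + by case: ifP => // _; rewrite size_rcons ltnS ltnW.
  split.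
  + by rewrite t'tail q1 t0E; case: ifP => _; rewrite ?addn0 // size_rcons addn1.
  + move=> i; rewrite t'queue t0E q1; case: ifP => _ /=; first exact: q2.
    rewrite size_rcons ltnS leq_eqVlt nth_rcons; case: (ltngtP i (size qs')) => // ? _; exact: q2.
  + case: ifP => S'q; split=> //; first by rewrite rcons_uniq S'q.
    by move=> T; rewrite mem_rcons inE => /orP[/eqP ->|/q4].
  + move=> T; rewrite w'E; case: (eqVneq T S') => [->|TS']; last first.
      by rewrite q5; case: ifP => // _; rewrite mem_rcons inE (negbTE TS').
    by rewrite addn_eq0 (negbTE c0) andbF; case: ifP => // _; rewrite mem_rcons inE eqxx.
  + move=> i j ij; case: ifP => S'q; first exact: q6.
    rewrite size_rcons ltnS => jq; rewrite !nth_rcons.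
    case: (ltngtP j (size qs')) jq => // [jq _|je _].
      by rewrite (leq_ltn_trans ij jq); exact: q6.
    case: (ltngtP i (size qs')) => // [iq|]; last by lia.
    by rewrite sS'; apply: qS'; rewrite mem_nth.
- move=> om; rewrite sumE vw wS mul1n mulnDr addnCA addnC -pot -/S' /potential.
  rewrite (eq_bigr (fun T => (if T == S' then t aWays (enc S') + s aCurWays 0 else t aWays (enc T)) * om T)).
    2: by move=> T _; rewrite w'E.
  move: drop'; case: ifP => S'q drop'.
    by rewrite (sum_update_seq (fun T => t aWays (enc T))) // drop_uniq.
  rewrite drop_rcons // -cats1 big_cat big_seq1 /= eqxx.
  have -> : t aWays (enc S') = 0 by apply/eqP; rewrite t0E S'q.
  rewrite add0n; congr (_ + _); apply: eq_big_seq => T TD; case: eqVneq => // e.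
  by move: TD; rewrite e => /mem_drop; rewrite S'q.
- split.
    move=> T Tk; rewrite w'E; case: eqVneq => [e|_]; last exact: keep.
    by move: S'take; rewrite tk -e Tk.
  move=> x; rewrite t'ways; case: eqVneq => [->|_]; first by right; exists S'.
  by case: (dom x) => [->|[T Td ->]]; [left|right; exists T => //; exact: dropsub].
- split.
  + by move=> i; rewrite t'queue; case: ifP => _; [right; exact: enc_lt|exact: bq].
  + by move=> i; rewrite t'new; case: ifP => _; [right; exact: enc_lt|exact: bn].
  + by move=> i i0; rewrite t'tl // bt.
Qed.


(** For the full set [aBest] holds the non-vertex [n]; it is never consulted, since every vertex is
    already covered. *)
Lemma extend_full s j : fixed s -> s aCur 0 = enc [set: 'I_n] -> j != vV ->
  sem n inp extend s j = s j.
Proof.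
move=> fs sc; move: j.
apply: (for_ind (P := fun _ (t : store) => forall j, j != vV -> t j = s j)) => //.
  move=> _ t v H j jV; rewrite -(H j jV); apply: functional_extensionality => i.
  by rewrite /upd2 (negbTE jV).
move=> k t lt_kn tv H j jV; rewrite sem_if (_ : (xev _ _ _ _ != 0) = true); first exact: H.
have ft : fixed t by rewrite /fixed !H.
by rewrite (xbitE (v := Ordinal lt_kn) ft _ tv (S := setT)) ?inE // H.
Qed.

Definition pm S := #|pm_avoiding G S|.
(* Its potential never increases, so that the numbers stored stay below n^n.  *)
Definition weight S := n ^ (n - #|S|).

Lemma children_pm S (v : 'I_n) : v \notin S ->
  \sum_(w | children S v n w) pm (v |: (w |: S)) = pm S.
Proof.
move=> vS; rewrite [RHS](pm_avoiding_rec G vS); apply: eq_bigl => w.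
by rewrite /children ltn_ord andbT.
Qed.

(** There are at most [n] children, and the exponent of each is smaller by 2. *)
Lemma children_weight S (v : 'I_n) : v \notin S ->
  \sum_(w | children S v n w) weight (v |: (w |: S)) <= weight S.
Proof.
move=> vS; case: (pickP (children S v n)) => [w0 /andP[/andP[vw0 w0S] _]|none]; last first.
  by rewrite big_pred0.
have := max_card (mem (v |: (w0 |: S))); rewrite card_child // card_ord => Sn.
apply: (@leq_trans (\sum_(w | children S v n w) n ^ (n - #|S|.+2))).
  by apply: leq_sum => w /andP[/andP[vw wS] _]; rewrite /weight card_child.
rewrite sum_nat_const /weight.
apply: (@leq_trans (n * n ^ (n - #|S|.+2))).
  by rewrite leq_mul2r -[X in _ <= X]card_ord max_card orbT.
by rewrite -expnS leq_pexp2l //; lia.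
Qed.

Lemma pmT : pm setT = 1. Proof. exact: pm_avoidingT. Qed.

Lemma size_uniq_sets (qs : seq {set 'I_n}) : uniq qs -> size qs <= 2 ^ n.
Proof.
move/card_uniqP <-; apply: leq_trans (max_card _) _.
by rewrite -cardsT -powersetT card_powerset cardsT card_ord.
Qed.

Variable M : nat.
Hypotheses (M_pow : 2 ^ n <= M) (M_exp : n ^ n <= M).

Lemma n_le_M : n <= M.
Proof. by apply: leq_trans M_pow; rewrite ltnW // ltn_expl. Qed.

(* The queue is sorted by cardinality: an extension of the set being           *)
(* processed has itself not been processed yet.                               *)
Definition loop_invariant_at (s : store) qs h :=
  [/\ fixed s,
      queue_state s qs,
      h <= size qs /\ (forall T T', T \in qs -> T' \in drop h qs -> #|T| <= #|T'|.+2),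
      potential s qs h pm + (setT \in take h qs) * s aWays (enc [set: 'I_n]) = pm set0 /\
      potential s qs h weight <= n ^ n
    & forall j i, s j i <= M].

Definition loop_invariant (s : store) := exists qs, loop_invariant_at s qs (s aHead 0).

(** Processing [S] replaces its term in the potential by those of its children. For [pm] this is the
    recurrence, and [weight] can only lose. The count of the full set, once processed, passes into
    the second summand of the invariant. *)
Lemma stepP s : loop_invariant s -> s aTail 0 - s aHead 0 != 0 ->
  loop_invariant (sem n inp step s) /\ sem n inp step s aHead 0 = (s aHead 0).+1.
Proof.
case=> qs; set h := s aHead 0; move=> [fs sqs [hq win] [potpm potw] sM] ne.
have [q1 q2 [q3 q4] q5 q6] := sqs.
have lt_h : h < size qs by rewrite q1 subn_eq0 -ltnNge in ne.
set S := nth set0 qs h.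
have Sqs : S \in qs by rewrite mem_nth.
set c := s aWays (enc S).
have c0 : c != 0 by rewrite q5.
have curE : s aQueue h = enc S by rewrite q2.
rewrite /step !sem_seq; set s1 := sem n inp pop s; set s2 := sem n inp select s1.
set s3 := sem n inp extend s2.
have cur1 : s1 aCur 0 = enc S by rewrite -curE.
have cw1 : s1 aCurWays 0 = c by rewrite /c -curE.
have head1 : s1 aHead 0 = h.+1 by rewrite /s1 /= /upd2 /= addn1.
have fs1 : fixed s1 by rewrite /fixed /s1 !sem_frame.
have fs2 : fixed s2 by rewrite /fixed /s2 !sem_frame.
have best1 i : s1 aBest i <= M.
  by rewrite /s1 /= /upd2 /=; case: eqP => // _; exact: n_le_M.
have [best2 nextS] := selectP fs1 cur1 (erefl : s1 aBest 0 = n) best1 n_le_M.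
rewrite -/s2 in best2 nextS.
have cur2 : s2 aCur 0 = enc S by rewrite /s2 sem_frame.
have sqs2 : queue_state s2 qs by rewrite /queue_state /s2 /s1 !sem_frame.
have ways2 : s2 aWays = s aWays by rewrite /s2 /s1 !sem_frame.
have pot2 om : potential s2 qs h.+1 om = potential s qs h.+1 om by rewrite /potential ways2.
have qsS T : T \in qs -> #|T| <= #|S|.+2.
  by move=> Tq; apply: win => //; rewrite (drop_nth set0 lt_h) inE eqxx.
have [qs' [fs3 [sqs3 tk3 hq3 qS3] [pm3 w3] [keep dom] [bq bn bt]]] : exists qs',
  [/\ fixed s3,
      [/\ queue_state s3 qs', take h.+1 qs' = take h.+1 qs, h < size qs'
        & forall T, T \in qs' -> #|T| <= #|S|.+2],
      potential s3 qs' h.+1 pm = potential s qs h.+1 pm + c * (if S == setT then 0 else pm S) /\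
      potential s3 qs' h.+1 weight <= potential s qs h.+1 weight + c * weight S,
      (forall T, T \in take h.+1 qs -> s3 aWays (enc T) = s aWays (enc T)) /\
      (forall x, s3 aWays x = s aWays x \/ exists2 T, T \in drop h.+1 qs' & x = enc T)
    & [/\ forall i, s3 aQueue i = s aQueue i \/ s3 aQueue i < 2 ^ n,
          forall i, s3 aNew i = s aNew i \/ s3 aNew i < 2 ^ n
        & forall i, i != 0 -> s3 aTail i = s aTail i]].
  (* In the first case [S] is the full set and the queue stays as it is. *)
  case: nextS => [[b2 ST]|[v b2 vS]].
    have s3E j : j != vV -> s3 j = s2 j by apply: extend_full; rewrite // -ST.
    have fr j : ~~ assigned j pop -> ~~ assigned j select -> j != vV -> s3 j = s j.
      by move=> h1 h2 h3; rewrite s3E // /s2 sem_frame // /s1 sem_frame.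
    exists qs; split.
    - by rewrite /fixed !fr.
    - by split=> //; rewrite /queue_state !fr.
    - by rewrite ST eqxx muln0 addn0 /potential !fr // leq_addr.
    - by rewrite !fr //; split=> // x; left.
    - by split=> i; rewrite !fr //; left.
  have cw2 : s2 aCurWays 0 = c by rewrite /s2 sem_frame.
  have [|qs' [[h1 _ _ _] [h2 h3 h4 h5] h6 [h7 h8] [h9 h10 h11]]] :=
    extendP fs2 cur2 b2 vS _ sqs2 lt_h erefl qsS; first by rewrite cw2.
  have nT : S != setT by apply: contraTneq vS.1 => ->; rewrite negbK inE.
  exists qs'; split=> //.
  - rewrite !h6 !pot2 cw2 children_pm ?vS.1 // (negbTE nT); split=> //.
    by rewrite leq_add2l leq_mul2l children_weight ?vS.1 ?orbT.
  - by rewrite -ways2.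
  - have s2E j : ~~ assigned j pop -> ~~ assigned j select -> s2 j = s j.
      by move=> ? ?; rewrite /s2 sem_frame // /s1 sem_frame.
    by rewrite -(s2E aQueue) // -(s2E aNew) // -(s2E aTail).
have dropE om : potential s qs h om = c * om S + potential s qs h.+1 om.
  by rewrite /potential (drop_nth set0 lt_h) big_cons.
have head3 : s3 aHead 0 = h.+1 by rewrite /s3 /s2 !sem_frame.
split=> //; exists qs'; rewrite head3.
have [r1 r2 [r3 r4] r5 r6] := sqs3.
have S3 : nth set0 qs' h = S by rewrite -(nth_take set0 (ltnSn h)) tk3 nth_take.
have pw3 : potential s3 qs' h.+1 weight <= n ^ n.
  by apply: leq_trans w3 _; apply: leq_trans potw; rewrite dropE addnC.
split=> //.
- split=> // T T' Tq /(nthP set0)[i]; rewrite size_drop nth_drop => lt_i <-.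
  apply: leq_trans (qS3 _ Tq) _; rewrite !ltnS -S3.
  by apply: r6; [rewrite addSn ltnW // ltnS leq_addr|rewrite -ltn_subRL].
- split=> //; rewrite pm3 tk3 (take_nth set0 lt_h) mem_rcons inE -/S.
  have keepT : setT \in take h qs -> s3 aWays (enc [set: 'I_n]) = s aWays (enc [set: 'I_n]).
    by move=> Tk; apply: keep; rewrite (take_nth set0 lt_h) mem_rcons inE Tk orbT.
  have nTk : [set: 'I_n] \in take h qs -> S != setT.
    move=> Tk; apply: contraTneq q3 => ST; rewrite -(cat_take_drop h qs) cat_uniq.
    apply/negP => /and3P[_ /hasPn/(_ S)]; rewrite (drop_nth set0 lt_h) inE eqxx ST => /(_ isT).
    by rewrite Tk.
  rewrite -potpm dropE; case Tk: (setT \in take h qs).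
    by rewrite (negbTE (nTk Tk)) orbT keepT //; lia.
  rewrite orbF [setT == S]eq_sym; case: eqVneq => [ST|nT]; last by lia.
  have -> : s3 aWays (enc [set: 'I_n]) = c.
    by rewrite /c ST; apply: keep; rewrite (take_nth set0 lt_h) mem_rcons inE -/S ST eqxx.
  by rewrite ST pmT; lia.
have sz : size qs' <= M by apply: leq_trans M_pow; exact: size_uniq_sets.
move=> j i; case aj: (assigned j (SSeq pop (SSeq select extend))); last first.
  by have := @sem_frame n inp _ s j (negbT aj); rewrite !sem_seq -/s1 -/s2 -/s3 => ->.
have var3 : s3 vV i <= M.
  rewrite /s3 /s2 for_var //; case: eqP => [_|i0]; first exact: n_le_M.
  by rewrite for_var //; case: eqP => // _; rewrite /s1 sem_frame.
have cur3 : s3 aCur i <= M.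
  by rewrite /s3 /s2 !sem_frame // /s1 /= /upd2 /=; case: eqP.
have cw3 : s3 aCurWays i <= M.
  by rewrite /s3 /s2 !sem_frame // /s1 /= /upd2 /=; case: eqP.
have head3i : s3 aHead i <= M.
  rewrite /s3 /s2 !sem_frame // /s1 /= /upd2 /=; case: eqP => // _.
  by rewrite -/h addn1; apply: leq_trans sz.
have tail3 : s3 aTail i <= M.
  by case: (eqVneq i 0) => [->|i0]; [rewrite r1|rewrite bt].
have best3 : s3 aBest i <= M by rewrite /s3 sem_frame.
have queue3 : s3 aQueue i <= M.
  by case: (bq i) => [->//|lt]; apply: leq_trans (ltnW lt) M_pow.
have new3 : s3 aNew i <= M.
  by case: (bn i) => [->//|lt]; apply: leq_trans (ltnW lt) M_pow.
(* A count that has changed belongs to a waiting set, and weights are positive; so it is at most the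
   potential for [weight]. *)
have ways3 : s3 aWays i <= M.
  case: (dom i) => [->//|[T Td ->]]; apply: leq_trans M_exp; apply: leq_trans pw3.
  rewrite /potential (bigD1_seq T) ?drop_uniq //=; apply: leq_trans (leq_addr _ _).
  apply: leq_pmulr; rewrite /weight expn_gt0; case: (posnP n) => //=.
  by move=> n0; apply/eqP; lia.
case: (eqVneq j vV) => [->//|/negbTE n0].
case: (eqVneq j aCur) => [->//|/negbTE n1].
case: (eqVneq j aCurWays) => [->//|/negbTE n2].
case: (eqVneq j aHead) => [->//|/negbTE n3].
case: (eqVneq j aTail) => [->//|/negbTE n4].
case: (eqVneq j aBest) => [->//|/negbTE n5].
case: (eqVneq j aQueue) => [->//|/negbTE n6].
case: (eqVneq j aNew) => [->//|/negbTE n7].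
case: (eqVneq j aWays) => [->//|/negbTE n8].
by move: aj; rewrite /= n0 n1 n2 n3 n4 n5 n6 n7 n8.
Qed.

End DynamicProgram.

(** * Running time *)

Definition nonempty : sexp := XB Defs.Sub (xvar aTail) (xvar aHead).
(** The entry of the full set, which has code [2 ^ n - 1]; it is 0 if this set was never reached. *)
Definition answer : sexp := XA aWays (XB Defs.Sub (XA aPow XN) (XC 1)).
Definition count_matchings : prog :=
  Seq (compile preprocess) (Seq (While (cx nonempty) (compile step)) (Put (Const 0) (cx answer))).

Lemma nth_allpairs_rect (S T U : Type) (f : S -> T -> U) s t x y z i j :
  i < size s -> j < size t ->
  nth z [seq f a b | a <- s, b <- t] (i * size t + j) = f (nth x s i) (nth y t j).
Proof.
elim: s i => // a s IH [|i] /= is_ jt; rewrite nth_cat size_map.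
  by rewrite mul0n add0n jt (nth_map y).
by rewrite ltnNge mulSn -addnA leq_addr /= addKn IH.
Qed.

Definition matrix_cell n (G : sgraph 'I_n) : nat -> nat := fun i => nth 0 (encode_graph G) i.+1.

Lemma matrix_cellE n (G : sgraph 'I_n) (u v : 'I_n) : matrix_cell G (u * n + v) = G u v.
Proof.
rewrite /matrix_cell /=; have := @nth_allpairs_rect _ _ _ (fun i j => nat_of_bool (G i j))
  (enum 'I_n) (enum 'I_n) u v 0 u v.
by rewrite size_enum_ord => -> //; rewrite !nth_ord_enum.
Qed.

Lemma load_input_img n (G : sgraph 'I_n) :
  load_input (encode_graph G) = img n (matrix_cell G) init_store.
Proof.
apply: functional_extensionality => -[|a] //=; case: ltnP => // na.
by rewrite /load_input /= nth_default // size_allpairs size_enum_ord.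
Qed.

Lemma matrix_cell_le1 n (G : sgraph 'I_n) i : matrix_cell G i <= 1.
Proof.
rewrite /matrix_cell /=; set s := (X in nth 0 X i).
have [lt|ge] := ltnP i (size s); last by rewrite nth_default.
by have /allpairsP[[u v] [_ _ ->]] := mem_nth 0 lt; case: (G _ _).
Qed.

Lemma leq_input_size n (G : sgraph 'I_n) : n <= input_size (encode_graph G).
Proof.
rewrite /input_size /encode_graph big_cons.
apply: (@leq_trans (n * n)); first by case: (n) => // k; rewrite leq_pmulr.
apply: leq_trans (leq_addl _ _).
have -> : n * n = size [seq nat_of_bool (G i j) | i <- enum 'I_n, j <- enum 'I_n].
  by rewrite size_allpairs size_enum_ord.
by rewrite -sum1_size; apply: leq_sum.
Qed.

Lemma assigned_lt_narr j p : swf p -> assigned j p -> j < narr.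
Proof.
elim: p => //= [k a e|p IHp q IHq|e p IHp q IHq|k p IH].
- by case/and4P => kn _ _ _ /eqP ->.
- by case/andP => /IHp hp /IHq hq /orP[].
- by case/and3P => _ /IHp hp /IHq hq /orP[].
- by case/and3P => kn _ /IH hp /orP[/eqP ->|].
Qed.

Definition start_bound n := (n + 2) * growth n preprocess.
(** The three summands account for the data left by the preprocessing, for codes and queue
    positions, and for the counts. *)
Definition cell_bound n := start_bound n + 2 ^ n + n ^ n.
Definition top_bound n := (cell_bound n + n + 2) * growth n step.

Lemma polyb_top : exists2 f, polyb f & forall n, bitlen (top_bound n) <= f n.
Proof.
have [g pg Hg] := polyb_growth preprocess; have [h ph Hh] := polyb_growth step.
pose F n := n + 2 + g n + n * n.
exists (fun n => F n + 2 + h n + 1).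
  have pF : polyb F.
    apply: polyb_add (polyb_mul polyb_id polyb_id); apply: polyb_add pg.
    exact: polyb_add polyb_id (polyb_cst 2).
  by apply: polyb_add (polyb_cst 1); apply: polyb_add ph; apply: polyb_add pF (polyb_cst 2).
move=> n; rewrite addn1; apply: bitlen_le => //; rewrite expnS.
apply: (@leq_ltn_trans (2 ^ (F n + 2 + h n))); last first.
  by rewrite mul2n -addnn -[X in X < _]addn0 ltn_add2l expn_gt0.
rewrite /top_bound expnD; apply: leq_mul => //.
have n2 : n + 2 <= 2 ^ (n + 2) by rewrite ltnW // ltn_expl.
have b1 : start_bound n <= 2 ^ F n.
  apply: (@leq_trans (2 ^ (n + 2) * 2 ^ g n)); first exact: leq_mul.
  by rewrite -expnD leq_exp2l // leq_addr.
have b2 : 2 ^ n <= 2 ^ F n by rewrite leq_exp2l // /F; lia.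
have b3 : n ^ n <= 2 ^ F n.
  apply: (@leq_trans (2 ^ (n * n))); last by rewrite leq_exp2l // /F leq_addl.
  by rewrite expnM; case: (n) => // k; rewrite leq_exp2r // ltnW // ltn_expl.
have b4 : n + 2 <= 2 ^ F n.
  by apply: leq_trans n2 _; rewrite leq_exp2l // /F; lia.
by rewrite /cell_bound expnD; lia.
Qed.

Definition time_factor n :=
  (cost n preprocess + (test_cost (cx nonempty) + cost n step)
     + put_cost (Const 0) (cx answer)) * bitlen (top_bound n).

Lemma polyb_time_factor : polyb time_factor.
Proof.
have [f pf Hf] := polyb_top.
apply: (@polyb_le _ (fun n => (cost n preprocess + (test_cost (cx nonempty) + cost n step)
     + put_cost (Const 0) (cx answer)) * f n)).
  apply: polyb_mul pf; apply: polyb_add (polyb_cst _); apply: polyb_add (polyb_cost _) _.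
  exact: polyb_add (polyb_cst _) (polyb_cost _).
by move=> n; rewrite leq_mul2l Hf orbT.
Qed.

Section Run.
Variables (n : nat) (G : sgraph 'I_n).
Let inp := matrix_cell G.
Let s0 := sem n inp preprocess init_store.

Lemma bounded_img s B : n <= B -> 0 < B -> (forall j i, s j i <= B) -> bounded B (img n inp s).
Proof.
move=> nB B0 sB [|a] //=; case: ifP => // _; exact: leq_trans (matrix_cell_le1 _ _) B0.
Qed.

Lemma preprocess_within :
  bounded (start_bound n) (img n inp s0) /\
  halts_within (img n inp init_store) (compile preprocess)
    (cost n preprocess * bitlen (start_bound n)) (img n inp s0).
Proof.
apply: compile_within preprocess_wf _ _; first by rewrite addn2.
by apply: bounded_img => //; lia.
Qed.

Lemma s0_le j i : s0 j i <= cell_bound n.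
Proof.
case aj: (assigned j preprocess); last first.
  by rewrite /s0 sem_frame ?aj.
rewrite -(img_loc n inp s0 i (assigned_lt_narr preprocess_wf aj)).
by apply: leq_trans (preprocess_within.1 _) _; rewrite /cell_bound -addnA leq_addr.
Qed.

(** The queue consists of distinct good sets, so [aHead] never exceeds their number [N], and
    [N - aHead] decreases in each round. *)
Lemma count_matchings_run (A : {set 'I_n}) : bipartition G A ->
  exists (A' : {set 'I_n}) (key : 'I_n -> nat),
    [/\ bipartition G A', #|~: A'| <= #|A'|,
        forall a a' b', a \in A' -> a' \in A' -> key a < key a' -> G a' b' ->
          exists2 b, G a b & rank G b <= rank G b'
      & exists t m, [/\ exec (load_input (encode_graph G)) count_matchings t m,
          m 0 = #|perfect_matchings G|
        & t <= #|[set S | good G A' key S]|.+1 * time_factor n]].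
Proof.
move=> bA.
have [A' [[bA' leA keyP] key_n powE ways0 [head0 tail0 queue0]]] :=
  preprocessP (matrix_cellE G) bA.
rewrite -/inp -/s0 in keyP key_n powE ways0 head0 tail0 queue0.
exists A', (fun v : 'I_n => s0 aKey v); split=> //.
  by move=> a a' b'; exact: (key_rank leA keyP key_n).
pose N := #|[set S | good G A' (fun v : 'I_n => s0 aKey v) S]|; rewrite -/N.
pose M := cell_bound n.
have M1 : 2 ^ n <= M by rewrite /M /cell_bound addnAC leq_addl.
have M2 : n ^ n <= M by rewrite /M /cell_bound leq_addl.
pose P := loop_invariant G A' (s0 aKey) M.
have e0 : enc (set0 : {set 'I_n}) = 0 by rewrite /enc big_set0.
have P0 : P s0.
  exists [:: set0]; rewrite head0; split.
  - by split.
  - split=> //.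
    + by case=> // _; rewrite queue0 /= e0.
    + by split=> // T; rewrite inE => /eqP ->; exact: good0.
    + move=> T; by rewrite ways0 eqb0 negbK inE -(inj_eq (@enc_inj n)) e0.
    + by case=> [|i] [|j].
  - by split=> // T T'; rewrite !inE => /eqP -> /eqP ->; rewrite cards0.
  - rewrite /potential /= !big_seq1 e0 ways0 eqxx !mul1n addn0; split=> //.
    by rewrite /weight cards0 subn0.
  - exact: s0_le.
have headN s : P s -> s aHead 0 <= N.
  case=> qs [_ [_ _ [uq gq] _ _] [hq _] _ _]; apply: leq_trans hq _.
  rewrite -(card_uniqP uq); apply/subset_leq_card/subsetP => T Tq.
  by rewrite inE; exact: gq.
have B2 : 1 < M + n + 2 by rewrite addn2.
have PB s : P s -> bounded (M + n + 2) (img n inp s).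
  case=> qs [_ _ _ _ sM]; apply: bounded_img; [lia|lia|].
  by move=> j i; apply: leq_trans (sM j i) _; rewrite -addnA leq_addr.
have Pstep s : P s -> xev n inp s nonempty != 0 ->
    P (sem n inp step s) /\ N - sem n inp step s aHead 0 < N - s aHead 0.
  move=> Ps ne; have [Ps' hs'] := stepP (matrix_cellE G) bA' leA keyP key_n M1 M2 Ps ne.
  by split=> //; have := headN _ Ps'; rewrite hs'; lia.
have [s1 [Ps1 end1 loop1]] :=
  @while_within n inp (M + n + 2) nonempty step P (fun s => N - s aHead 0)
    isT step_wf B2 PB Pstep s0 P0.
cbv beta in loop1; rewrite head0 subn0 in loop1.
have ansE : xev n inp s1 answer = #|perfect_matchings G|.
  case: Ps1 => qs [[_ pw] [q1 _ [uq _] q5 _] [hq _] [pot _] _].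
  rewrite /= pw // -encT -pm_avoiding0 -[RHS]/(pm G set0) -pot.
  (* On exit no set is waiting, and the invariant reduces to the entry of the full set. *)
  have -> : s1 aHead 0 = size qs.
    apply/eqP; rewrite eqn_leq hq -q1 /= -subn_eq0; exact/eqP.
  rewrite /potential drop_size big_nil take_size add0n.
  by case: (boolP (setT \in qs)) => [_|]; rewrite ?mul1n // -q5 negbK => /eqP ->.
have [t1 e1 b1] := preprocess_within.2; have [t2 e2 b2] := loop1.
have [t3 e3 b3] := put_within (Const 0) (cx answer) B2 (PB _ Ps1).
eexists; eexists; split.
- rewrite load_input_img; exact: ExecSeq e1 (ExecSeq e2 e3).
- by rewrite /upd /= -[RHS]ansE -(eval_cx n inp s1 (isT : xwf answer)).
- have g0 := growth_gt0 n step.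
  have l1 : bitlen (start_bound n) <= bitlen (top_bound n).
    apply: bitlen_mono; apply: leq_trans (leq_pmulr _ g0).
    by rewrite /cell_bound -!addnA leq_addr.
  have l3 : bitlen (M + n + 2) <= bitlen (top_bound n).
    by apply: bitlen_mono; exact: leq_pmulr.
  rewrite /time_factor; move: b1 b2 b3; rewrite -[(M + n + 2) * _]/(top_bound n).
  move: l1 l3; move: (bitlen (start_bound n)) (bitlen (M + n + 2)) (bitlen (top_bound n)) => x y z xz yz.
  move: (cost n preprocess) (test_cost _ + _) (put_cost _ _) => a b c h1 h2 h3.
  have h1' : t1 <= a * z by apply: leq_trans h1 _; rewrite leq_mul2l xz orbT.
  have h3' : t3 <= c * z by apply: leq_trans h3 _; rewrite leq_mul2l yz orbT.
  rewrite !mulnDl !mulnDr; apply: leq_trans (_ : a * z + (N.+1 * (b * z) + c * z) <= _).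
    by rewrite !leq_add.
  by rewrite addnA !leq_add // leq_pmull.
Qed.

End Run.

(** * The exponent *)

Import Order.TTheory GRing.Theory Num.Theory.
Local Open Scope ring_scope.

(** Indeed (3/2)^5 = 243/32 < 8 = 2^3. *)
Lemma three_halves_le_powR (R : realType) : 3 / 2 <= 2 `^ (3 / 5) :> R.
Proof.
rewrite -(@ler_pXn2r _ 5) ?nnegrE ?powR_ge0 //; last by lra.
rewrite -[X in _ <= X]powR_mulrn ?powR_ge0 // -powRrM (_ : 3 / 5 * 5%:R = 3%:R); last by lra.
by rewrite powR_mulrn //; lra.
Qed.

(** By symmetry [q] may be replaced by [N - q]; then [bin_le_3pow], which keeps one term of (2 +
    1)^N, gives (3/2)^N 2^(N - q). *)
Lemma bin_le_powR (R : realType) (N q : nat) : (q <= N)%N ->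
  'C(N, q)%:R <= 2 `^ (3 / 5 * N%:R + (N%:R - q%:R)) :> R.
Proof.
move=> qN; rewrite -natrB // -bin_sub //; have : (N - q <= N)%N by rewrite leq_subr.
move: (N - q)%N => {qN}q qN.
have h : ('C(N, q) * 2 ^ N <= 3 ^ N * 2 ^ q)%N.
  rewrite -{2}(subnK qN) expnD mulnA leq_mul2r; apply/orP; right; exact: bin_le_3pow.
rewrite powRD; last by rewrite pnatr_eq0 implybT.
rewrite powRrM !powR_mulrn ?powR_ge0 //.
apply: (@le_trans _ _ ((3 / 2) ^+ N * 2 ^+ q)).
  rewrite expr_div_n mulrAC ler_pdivlMr ?exprn_gt0 //.
  by rewrite -!natrX -!natrM ler_nat.
by rewrite ler_wpM2r ?exprn_ge0 // lerXn2r ?nnegrE ?powR_ge0 ?three_halves_le_powR //; lra.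
Qed.

Section Rate.
Variables (R : realType) (d : R).
Hypothesis d_ge1 : 1 <= d.

Let u := d^-1.
Let d_gt0 : 0 < d. Proof. exact: lt_le_trans ltr01 d_ge1. Qed.
Let d_neq0 : d != 0. Proof. by rewrite gt_eqF. Qed.
Let u_gt0 : 0 < u. Proof. by rewrite invr_gt0. Qed.
Let u_le1 : u <= 1. Proof. by rewrite invf_le1. Qed.

Lemma rateE (k : R) : (1 - 1 / (355 / 100 * d)) * k = k - 100 / 355 * u * k.
Proof.
rewrite mulrBl mul1r; congr (_ - _ * _); by rewrite /u; field.
Qed.

(** The two alternatives are the exponents of the two binomial estimates. With rho = r/k the
    hypothesis reads rho u b <= delta + 1, and everything is compared through rho. *)
Lemma rate_case_split (k b delta r : R) :
  0 < k -> 0 <= b -> b <= k -> 0 <= r -> r * b <= (delta + 1) * (d * k) ->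
  b - delta <= k - 100 / 355 * u * k + 1
  \/ 3 / 5 * (b - delta) + (r - delta) <= k - 100 / 355 * u * k + 2.
Proof.
move=> k0 b0 bk r0 rb; have [u0 u1] := (u_gt0, u_le1).
pose rho := r / k.
have rE : r = rho * k by rewrite /rho mulfVK // gt_eqF.
have rho0 : 0 <= rho by rewrite divr_ge0 // ltW.
have hd : rho * u * b <= delta + 1.
  have dk0 : 0 < d * k by rewrite mulr_gt0.
  rewrite -(ler_pM2r dk0); apply: le_trans rb; rewrite rE le_eqVlt; apply/orP; left; apply/eqP.
  by rewrite /u; field.
(* The threshold is 1/3.55 because for larger [rho] the bound on [delta] alone yields the desired
   exponent, up to 1. *)
case: (lerP (100 / 355) rho) => hr; [left|right].
  have h1 : 100 / 355 * u * b <= rho * u * b by rewrite !ler_wpM2r // ltW.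
  have h2 : 0 <= (k - b) * (1 - 100 / 355 * u) by rewrite mulr_ge0; lra.
  lra.
have ru : rho * u <= 100 / 355.
  apply: le_trans (_ : 100 / 355 * 1 <= _); last by lra.
  by rewrite ler_pM // ltW.
(* The coefficient of [b] is nonnegative, so that [b] may be replaced by [k]. *)
have h1 : 0 <= (k - b) * (3 / 5 - 8 / 5 * (rho * u)) by rewrite mulr_ge0; lra.
(* What remains after division by [k]. In both cases the left side is at most 1/3.55 < 2/5; the
   additive error 8/5 is rounded up to 2. *)
have h2 : rho * (1 - 8 / 5 * u) + 100 / 355 * u <= 2 / 5.
  case: (lerP 0 (1 - 8 / 5 * u)) => hu.
    have : rho * (1 - 8 / 5 * u) <= 100 / 355 * (1 - 8 / 5 * u) by rewrite ler_wpM2r // ltW.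
    lra.
  have : rho * (1 - 8 / 5 * u) <= 0 by rewrite mulr_ge0_le0 // ltW.
  lra.
have h3 : 0 <= k * (2 / 5 - (rho * (1 - 8 / 5 * u) + 100 / 355 * u)) by rewrite mulr_ge0; lra.
rewrite {}rE; lra.
Qed.

(** The factor 4 = 2^2 absorbs the additive constants of [rate_case_split]. Since [b <= a], the
    excess of [b - delta] over [a - r] is at most [r - delta]. *)
Lemma bin_le_rate (a b delta r m : nat) (k := (a + b)%:R / 2 : R) :
  (b <= a)%N -> (r <= a)%N -> (delta <= b)%N -> m%:R <= d * k ->
  delta = b \/ (r * b <= delta.+1 * m)%N ->
  'C(b - delta, a - r)%:R <= 4 * 2 `^ ((1 - 1 / (355 / 100 * d)) * k).
Proof.
move=> ba ra db md H; rewrite rateE; have [u0 u1] := (u_gt0, u_le1).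
have bk : b%:R <= k by rewrite /k natrD; have : b%:R <= a%:R :> R by [rewrite ler_nat]; lra.
have k0 : 0 <= k by apply: le_trans bk; rewrite ler0n.
have E0 : 0 <= k - 100 / 355 * u * k.
  have : 0 <= k * (1 - 100 / 355 * u) by rewrite mulr_ge0 //; lra.
  lra.
set E := k - _ in E0 *.
have pow4 x : x <= E + 2 -> 2 `^ x <= 4 * 2 `^ E.
  move=> xE; apply: le_trans (_ : 2 `^ (E + 2) <= _); first by rewrite ler_powR //; lra.
  rewrite powRD; last by rewrite pnatr_eq0 implybT.
  by rewrite mulrC ler_wpM2r ?powR_ge0 // powR_mulrn //; lra.
(* If [b = 0] then also [delta = b], and the binomial coefficient is at most 1. *)
have [->|rb] : delta = b \/ (0 < b)%N /\ (r * b <= delta.+1 * m)%N.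
  by case: H => [->|H]; [left|case: (b) db H => [|b']; [rewrite leqn0 => /eqP ->; left|right]].
  rewrite subnn bin0n; apply: le_trans (pow4 0 _); last by lra.
  by rewrite powRr0; case: (_ == _).
case: rb => b_gt0 rb.
have kgt0 : 0 < k by apply: lt_le_trans bk; rewrite ltr0n.
have rbR : r%:R * b%:R <= (delta%:R + 1) * (d * k) :> R.
  apply: le_trans (_ : (delta%:R + 1) * m%:R <= _).
    by rewrite natr1 -!natrM ler_nat.
  by rewrite ler_wpM2l // addr_ge0.
have [h|h] := rate_case_split kgt0 (ler0n _ b) bk (ler0n _ r) rbR.
  apply: le_trans (_ : 2 `^ (b - delta)%:R <= _).
    by rewrite powR_mulrn // -natrX ler_nat bin_le_2pow.
  by apply: pow4; rewrite natrB // /E; lra.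
case: (leqP (a - r) (b - delta)) => hq; last by rewrite bin_small // mulr_ge0 ?powR_ge0.
apply: le_trans (bin_le_powR R hq) _; apply: pow4.
have : b%:R <= a%:R :> R by rewrite ler_nat.
by rewrite !natrB // /E; lra.
Qed.

End Rate.

(** * The number of good sets and the conclusion *)

Lemma card_good_le (R : realType) (d : R) (V : finType) (G : sgraph V)
    (A : {set V}) (key rk : V -> nat) : 1 <= d ->
  (forall v w, G v w -> (v \in A) != (w \in A)) -> (#|~: A| <= #|A|)%N ->
  injective rk ->
  (forall b b', (rk b < rk b')%N -> (degree G b <= degree G b')%N) ->
  (forall a a' b', a \in A -> a' \in A -> (key a < key a')%N -> G a' b' ->
     exists2 b, G a b & (rk b <= rk b')%N) ->
  average_degree G R <= d ->
  #|[set S | good G A key S]|%:R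
    <= (4 * #|V|.+1)%:R * 2 `^ ((1 - 1 / (355 / 100 * d)) * (#|V|%:R / 2)) :> R.
Proof.
move=> d1 bip BA rki rkd krk avg; set E := _ * (_ / 2).
have cV : (#|A| + #|~: A| = #|V|)%N by rewrite -(cardsC A).
have mle : (\sum_(b in ~: A) degree G b)%N%:R <= d * ((#|A| + #|~: A|)%:R / 2) :> R.
  rewrite cV; have := sum_degree_bip bip; set m := (\sum_(b in _) _)%N => hm.
  move: avg; rewrite /average_degree hm natrM.
  (* On the empty graph the average degree is a quotient by 0 and carries no information, but there
     are no edges. *)
  case: (posnP #|V|) => [V0 _|V0].
    suff -> : m = 0%N by rewrite V0 mul0r mulr0.
    by rewrite /m big1 // => b; have := fintype0 b; rewrite V0.
  rewrite ler_pdivrMr ?ltr0n // => h; lra.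
have lev (r : 'I_#|A|.+1) : #|[set S | good G A key S && (#|A :\: S| == r)]|%:R <= 4 * 2 `^ E :> R.
  have rA : (r <= #|A|)%N by rewrite -ltnS.
  have [delta [dB H1 H2]] := card_good_level bip rki rkd krk rA.
  apply: le_trans (_ : 'C(#|~: A| - delta, #|A| - r)%:R <= _); first by rewrite ler_nat.
  by rewrite /E -cV; apply: bin_le_rate H1.
apply: le_trans (_ : (\sum_(r < #|A|.+1) #|[set S | good G A key S && (#|A :\: S| == r)]|)%N%:R <= _).
  rewrite ler_nat; apply: leq_trans (_ : #|\bigcup_(r < #|A|.+1) [set S | good G A key S && (#|A :\: S| == r)]| <= _)%N.
    apply/subset_leq_card/subsetP => S; rewrite inE => gS.
    have lt : (#|A :\: S| < #|A|.+1)%N by rewrite ltnS subset_leq_card // subsetDl.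
    by apply/bigcupP; exists (Ordinal lt) => //; rewrite inE gS /=.
  elim/big_ind2: _ => [|x1 x2 y1 y2 h1 h2|b _]; rewrite ?cards0 //.
  by apply: leq_trans (leq_card_setU _ _) _; exact: leq_add.
rewrite natr_sum; apply: le_trans (_ : \sum_(r < #|A|.+1) 4 * 2 `^ E <= _).
  by apply: ler_sum => r _; exact: lev.
rewrite sumr_const card_ord -[X in X <= _]mulr_natl mulrA ler_wpM2r ?powR_ge0 //.
by rewrite -natrM ler_nat mulnC leq_mul2l ltnS max_card.
Qed.

Lemma rank_inj n (G : sgraph 'I_n) : injective (rank G).
Proof.
move=> u v; rewrite /rank => /(congr1 (modn^~ n)).
by rewrite ![(_ + _ * _)%N]addnC !modnMDl !modn_small // => /val_inj.
Qed.

Lemma rank_degree n (G : sgraph 'I_n) u v :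
  (rank G u < rank G v)%N -> (degree G u <= degree G v)%N.
Proof.
rewrite /rank; have := ltn_ord v; move: (degree G u) (degree G v) => x y vn lt.
rewrite leqNgt; apply/negP => yx; have := leq_mul yx (leqnn n).
by rewrite mulSn; lia.
Qed.

Theorem theorem1p3 (R : realType) (d : R) (d_ge1 : 1 <= d) :
  exists p : prog, exists q : {poly nat},
  forall (n : nat) (G : sgraph 'I_n),
    bipartite G -> average_degree G R <= d ->
  exists (t : nat) (m : memory),
    [/\ exec (load_input (encode_graph G)) p t m,
        m 0%N = #|perfect_matchings G|
      & t%:R <= q.[input_size (encode_graph G)]%:R
                * 2 `^ ((1 - 1 / (355 / 100 * d)) * (n%:R / 2))].
Proof.
have [k timeE] := polyb_time_factor.
(* The 3 comes from 4 (n + 1) + 1 <= (n + 2)^3; moreover [n] is at most the input size. *)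
exists count_matchings, (('X + 2%:P) ^+ (k + 3)) => n G [A bA] avg.
have [A' [key [bA' leA krk [t [m [run ans time]]]]]] := count_matchings_run bA.
exists t, m; split=> //.
set E := _ * (_ / 2).
have good_le : #|[set S | good G A' key S]|%:R <= (4 * n.+1)%:R * 2 `^ E :> R.
  by have := card_good_le d_ge1 bA' leA (@rank_inj n G) (@rank_degree n G) krk avg; rewrite card_ord.
(* Since 2^E >= 1, the additional round in the time bound is absorbed by one more 2^E. *)
have E_ge0 : 0 <= E.
  rewrite /E mulr_ge0 ?divr_ge0 // subr_ge0 ler_pdivrMr; lra.
have pow_ge1 : 1 <= 2 `^ E :> R by rewrite -[X in X <= _](powRr0 2) ler_powR //; lra.
apply: le_trans (_ : ((4 * n.+1).+1 * (n + 2) ^ k)%N%:R * 2 `^ E <= _).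
  apply: le_trans (_ : (#|[set S | good G A' key S]|.+1 * (n + 2) ^ k)%N%:R <= _).
    by rewrite ler_nat; apply: leq_trans time _; rewrite leq_mul2l timeE orbT.
  rewrite !natrM mulrAC ler_wpM2r // -natr1 -[X in _ <= X * _]natr1 mulrDl mul1r.
  exact: lerD.
rewrite ler_wpM2r ?powR_ge0 // ler_nat horner_exp hornerD hornerX hornerC natrXE natrDE.
apply: (@leq_trans ((n + 2) ^ (k + 3))%N); last first.
  by rewrite leq_exp2r ?addn_gt0 ?orbT // leq_add2r leq_input_size.
rewrite mulnC expnD leq_mul2l !expnS expn0; apply/orP; right; nia.
Qed.
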